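(* Let $n$, $d$ and $r\le n$ be positive integers. Let 1. $(\lambda-\mu_1),\dots,(\lambda-\mu_s)$ be $s$ scalar monic polynomials of degree $1$, where $\mu_1,\dots,\mu_s\in\mathbb C$ satisfy $\mu_i\ne\mu_j$ if $i\ne j$; 2. $t\in\{0,1\}$; and 3. $\varepsilon_1,\dots,\varepsilon_{n-r}$ be a list of nonnegative integers. Then there exists an $n\times n$ symmetric matrix polynomial $P(\lambda)\in\mathbb C[\lambda]^{n\times n}$ with rank $r$, grade $d$, finite elementary divisors $(\lambda-\mu_1),\dots,(\lambda-\mu_s)$, $t$ infinite elementary divisors of degree $1$, and right minimal indices equal to $\varepsilon_1,\dots,\varepsilon_{n-r}$ (and, as a consequence, also left minimal indices equal to $\varepsilon_1,\dots,\varepsilon_{n-r}$), if and only if the following condition holds: (a) $\displaystyle s+t+2\sum_{i=1}^{n-r}\varepsilon_i=r\,d.$ Moreover, assuming that (a) holds, the degree of $P(\lambda)$ is exactly equal to $d$ if and only if $t<r$.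
   Context: A matrix polynomial of grade $d$ is $P(\lambda)=\lambda^dA_d+\cdots+\lambda A_1+A_0$ with complex matrix coefficients, where $A_d$ may be zero (so the degree, i.e. the largest $i$ with $A_i\neq 0$, is at most $d$); it is symmetric if all $A_i^\top=A_i$. The rank of $P$ is its rank over the field $\mathbb C(\lambda)$. Finite eigenvalues and finite elementary divisors $(\lambda-\mu)^{\delta}$ are those obtained from the Smith form of $P$ (prime-power factors of the invariant polynomials); the listed finite (respectively, infinite) elementary divisors are all the finite (respectively, infinite) elementary divisors of $P$. The infinite elementary divisors of $P$, regarded with grade $d$, are the elementary divisors at $0$ of $\operatorname{rev}P(\lambda):=\lambda^dP(1/\lambda)$ (this definition applies even if the degree of $P$ is less than $d$). The right (left) minimal indices of $P$ are the degrees of the vectors in a minimal basis (polynomial basis with minimal sum of degrees) of the right (left) null-space of $P$ over $\mathbb C(\lambda)$; for symmetric $P$ the left and right minimal indices coincide. The lists of elementary divisors and of minimal indices may be empty. *)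

(* Defs.v *)
From HB Require Import structures.
From mathcomp Require Import all_boot all_order all_algebra.
From mathcomp Require Import fraction reals complex.

Set Implicit Arguments.
Unset Strict Implicit.
Unset Printing Implicit Defensive.

Import Order.TTheory GRing.Theory Num.Theory.
Local Open Scope ring_scope.

(* A matrix polynomial is a matrix with polynomial entries;
   [coef_matrix P k] is its coefficient A_k. *)

Section MatrixPolynomials.
Variable F : closedFieldType.

Definition coef_matrix (m n : nat) (P : 'M[{poly F}]_(m, n)) (k : nat) :
  'M[F]_(m, n) := \matrix_(i, j) (P i j)`_k.

Definition has_grade (m n : nat) (P : 'M[{poly F}]_(m, n)) (d : nat) : Prop :=
  forall k : nat, (d < k)%N -> coef_matrix P k = 0.

Definition has_degree (m n : nat) (P : 'M[{poly F}]_(m, n)) (d : nat) : Prop :=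
  coef_matrix P d != 0 /\ has_grade P d.

Definition symmetric_mxpoly (n : nat) (P : 'M[{poly F}]_n) : Prop :=
  forall k : nat, (coef_matrix P k)^T = coef_matrix P k.

Definition frac_mx (m n : nat) (P : 'M[{poly F}]_(m, n)) :
  'M[{fraction {poly F}}]_(m, n) := map_mx (@tofrac {poly F}) P.

Definition mxpoly_rank (m n : nat) (P : 'M[{poly F}]_(m, n)) : nat :=
  \rank (frac_mx P).

(* lambda^d P(1/lambda), for P of grade d *)
Definition rev_mxpoly (d m n : nat) (P : 'M[{poly F}]_(m, n)) :
  'M[{poly F}]_(m, n) := \matrix_(i, j) \poly_(k < d.+1) (P i j)`_(d - k).

(* [gs] is the list of the (nonzero, monic) invariant polynomials of P, each
   dividing the next; the diagonal of the Smith form is completed by zeros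
   (the default value of gs`_i for size gs <= i). *)
Definition invariant_polynomials (n : nat) (P : 'M[{poly F}]_n)
    (gs : seq {poly F}) : Prop :=
  [/\ (size gs <= n)%N,
      all (fun g => g \is monic) gs,
      sorted (@dvdp F) gs &
      exists U V : 'M[{poly F}]_n,
        [/\ U \in unitmx, V \in unitmx &
            U *m P *m V = diag_mx (\row_(i < n) gs`_i)]].

Definition poly_roots (g : {poly F}) : seq F :=
  undup (sval (closed_field_poly_normal g)).

Definition prime_power_factors (g : {poly F}) : seq {poly F} :=
  [seq ('X - a%:P) ^+ mup a g | a <- poly_roots g].

(* The lists of elementary divisors and of minimal indices below are multisets:
   they are determined up to the order of their items. *)
Definition finite_elementary_divisors (n : nat) (P : 'M[{poly F}]_n)
    (L : seq {poly F}) : Prop :=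
  exists gs : seq {poly F}, invariant_polynomials P gs /\
    perm_eq (flatten [seq prime_power_factors g | g <- gs]) L.

Definition elementary_divisors_at (a : F) (n : nat) (P : 'M[{poly F}]_n)
    (L : seq {poly F}) : Prop :=
  exists L' : seq {poly F}, finite_elementary_divisors P L' /\
    perm_eq [seq q <- L' | root q a] L.

Definition infinite_elementary_divisors (d n : nat) (P : 'M[{poly F}]_n)
    (L : seq {poly F}) : Prop :=
  elementary_divisors_at 0 (rev_mxpoly d P) L.

(* Subspaces of F(lambda)^n are represented, as in mxalgebra, as row spaces:
   the rows of B are polynomial vectors forming a basis of the row space of V. *)
Definition polynomial_basis (n k : nat) (V : 'M[{fraction {poly F}}]_n)
    (B : 'M[{poly F}]_(k, n)) : Prop :=
  row_free (frac_mx B) /\ (frac_mx B == V)%MS.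

Definition row_degree (k n : nat) (B : 'M[{poly F}]_(k, n)) (i : 'I_k) : nat :=
  (\max_(j < n) (size (B i j)).-1)%N.

Definition minimal_basis (n k : nat) (V : 'M[{fraction {poly F}}]_n)
    (B : 'M[{poly F}]_(k, n)) : Prop :=
  polynomial_basis V B /\
  forall B' : 'M[{poly F}]_(k, n), polynomial_basis V B' ->
    (\sum_(i < k) row_degree B i <= \sum_(i < k) row_degree B' i)%N.

Definition minimal_indices (n : nat) (V : 'M[{fraction {poly F}}]_n)
    (eps : seq nat) : Prop :=
  exists (k : nat) (B : 'M[{poly F}]_(k, n)),
    minimal_basis V B /\ perm_eq [seq row_degree B i | i : 'I_k] eps.

(* [kermx A] is the space of the row vectors u such that u *m A = 0, so that
   the space of the x such that P *m x = 0 is, up to transposition of x,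
   kermx P^T. *)
Definition left_minimal_indices (n : nat) (P : 'M[{poly F}]_n)
    (eps : seq nat) : Prop :=
  minimal_indices (kermx (frac_mx P)) eps.

Definition right_minimal_indices (n : nat) (P : 'M[{poly F}]_n)
    (eps : seq nat) : Prop :=
  minimal_indices (kermx (frac_mx P)^T) eps.

(* An infinite elementary divisor of degree 1 is the elementary divisor 'X of
   the reversal. *)
Definition has_spectral_data (n d r : nat) (mu : seq F) (t : nat)
    (eps : seq nat) (P : 'M[{poly F}]_n) : Prop :=
  [/\ mxpoly_rank P = r,
      has_grade P d,
      finite_elementary_divisors P [seq 'X - m%:P | m <- mu],
      infinite_elementary_divisors d P (nseq t 'X) &
      right_minimal_indices P eps].

End MatrixPolynomials.

(* Main.v *)
Require Import Defs.
From HB Require Import structures.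
From mathcomp Require Import all_boot all_order all_algebra.
From mathcomp Require Import fingroup perm action primitive_action alt.
From mathcomp Require Import fraction reals complex.
From mathcomp Require Import zify ring.

(* Write N for a minimal basis of the null space of P.  Necessity is the index
   sum theorem, proved by computing the largest degree of an r x r minor of P in
   two ways.  From a Smith form U P V = diag(g_1, ..., g_r, 0, ...) it is
   s + 2 * sum eps: the product of the g_i has degree s, and the maximal minors
   of the first r rows of V^-1 are, by Jacobi's identity, those of a basis of the
   null space, whose largest degree is the sum of the minimal indices; by
   symmetry the same holds for U.  From a Smith form of the reversal it is
   r d - t, since t is the order at 0 of the product of its invariant
   polynomials.  The leading coefficient of P is the value at 0 of the reversal,
   so it has rank r - t.

   For sufficiency, P = M^T D M.  Here M (r x n) and N are dual minimal bases
   whose row degrees eta and eps have the same sum; eta is chosen as balanced as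
   possible, so that there is an involution sigma with
   eta_i + eta_(sigma i) <= d.  D is the matrix with entries p_i at
   (i, sigma i), where p_i has grade d - eta_i - eta_(sigma i) and the p_i
   share out the prescribed eigenvalues, infinity included.  Both M and its
   rowwise reversal extend to unimodular matrices, so the elementary divisors of
   P, finite and infinite, are those of D. *)

Set Implicit Arguments.
Unset Strict Implicit.
Unset Printing Implicit Defensive.

Import Order.TTheory GRing.Theory Num.Theory.
Local Open Scope ring_scope.

(** * Minors and unimodular matrices *)

Lemma rank_diag_mx (K : fieldType) n (d : 'rV[K]_n) :
  \rank (diag_mx d) = (\sum_i (d 0%R i != 0%R))%N.
Proof.
elim: n d => [|n IHn] d; first by rewrite flatmx0 mxrank0 big_ord0.
rewrite -[n.+1]/(1 + n)%N in d *.
rewrite -[d]hsubmxK diag_mx_row rank_diag_block_mx IHn big_split_ord big_ord1.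
congr (_ + _)%N; last by apply: eq_bigr => i _; rewrite row_mxEr.
rewrite row_mxEl rank_rV; congr (nat_of_bool (~~ _)).
apply/eqP/eqP => [/matrixP/(_ 0 0)|d0]; first by rewrite !mxE eqxx mulr1n.
by apply/matrixP => i j; rewrite !ord1 !mxE eqxx mulr1n -[RHS]d0 mxE.
Qed.

Lemma diag_mx_nth_block (R : comNzRingType) r k (gs : seq R) : (size gs <= r)%N ->
  diag_mx (\row_(i < r + k) gs`_i) =
  block_mx (diag_mx (\row_(i < r) gs`_i)) 0 0 (0 : 'M_k).
Proof.
move=> le_gs; rewrite (_ : \row_(i < r + k) _ = row_mx (\row_(i < r) gs`_i) 0).
  by rewrite diag_mx_row (_ : diag_mx 0 = 0) //; apply/matrixP => i j; rewrite !mxE mul0rn.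
apply/rowP => i; rewrite !mxE; case: splitP => j ->; rewrite mxE //.
by rewrite nth_default // (leq_trans le_gs) ?leq_addr.
Qed.

Lemma row_free_minor (K : fieldType) k n (A : 'M[K]_(k, n)) :
  row_free A -> exists f : 'I_k -> 'I_n, \det (colsub f A) != 0.
Proof.
move=> freeA; have fullA : row_full A^T by rewrite /row_full mxrank_tr.
exists (fullrankfun fullA).
have := fullrowsub_unit fullA; rewrite -unitmx_tr unitmxE unitfE.
by congr (\det _ != 0); apply/matrixP => i j; rewrite !mxE.
Qed.

(** This is the k-fold transitivity of the symmetric group. It lets a permutation bring any chosen
    columns to the front or to the end. *)
Lemma perm_of_injections (T : finType) k (e f : 'I_k -> T) :
  injective e -> injective f -> exists s : {perm T}, forall i, s (e i) = f i.
Proof.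
move=> inj_e inj_f.
have lekT : (k <= #|T|)%N by rewrite -[k]card_ord; apply: leq_card inj_e.
have := ntransitive_weak lekT (Sym_trans T) => /atransP2 trT.
have dT (g : 'I_k -> T) : injective g -> [tuple g i | i < k] \in k.-dtuple([set: T]).
  move=> inj_g; rewrite inE; apply/andP; split; last by apply/subsetP => x; rewrite inE.
  by rewrite map_inj_uniq ?enum_uniq.
have [s _ Es] := trT _ _ (dT _ inj_e) (dT _ inj_f).
exists s => i; have /(congr1 (fun t => tnth t i)) := Es.
by rewrite !tnth_map !tnth_ord_tuple.
Qed.

Lemma det_colsub_noninj (R : comNzRingType) k n (A : 'M[R]_(k, n))
    (f : 'I_k -> 'I_n) : ~ injective f -> \det (colsub f A) = 0.
Proof.
move=> ninj_f; have /injectivePn[i [j neq_ij eq_f]] : ~~ injectiveb f.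
  by apply/negP => /injectiveP.
rewrite -det_tr; apply: (determinant_alternate neq_ij) => l.
by rewrite !mxE eq_f.
Qed.

Lemma det_colsub_mul (R : comNzRingType) k n (T : 'M[R]_k) (A : 'M_(k, n))
    (g : 'I_k -> 'I_n) : \det (colsub g (T *m A)) = \det T * \det (colsub g A).
Proof. by rewrite mxsub_mul mxsub_id det_mulmx. Qed.

(* Jacobi's identity for complementary minors, up to the choice of the rows
   and columns. *)
Lemma det_ulsubmx_inverse (R : comNzRingType) r k (A B : 'M[R]_(r + k)) :
  A *m B = 1%:M -> \det (ulsubmx A) = \det A * \det (drsubmx B).
Proof.
move=> AB1; pose C := block_mx 1%:M (ursubmx B) 0 (drsubmx B).
have -> : \det (drsubmx B) = \det C by rewrite det_ublock det1 mul1r.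
rewrite -det_mulmx.
suff -> : A *m C = block_mx (ulsubmx A) 0 (dlsubmx A) 1%:M.
  by rewrite det_lblock det1 mulr1.
have := AB1; rewrite -{1}[A]submxK -{1}[B]submxK mulmx_block scalar_mx_block.
case/eq_block_mx => _ AB12 _ AB22.
by rewrite -{1}[A]submxK mulmx_block !mulmx1 !mulmx0 !addr0 AB12 AB22.
Qed.

Section PolynomialMatrices.
Variable F : fieldType.
Implicit Types (p q : {poly F}).

Lemma size_prod_leq (I : finType) (p : I -> {poly F}) (e : I -> nat) :
    (forall i, size (p i) <= (e i).+1)%N ->
  (size (\prod_i p i)%R <= (\sum_i e i).+1)%N /\
  (\prod_i p i)`_(\sum_i e i) = \prod_i (p i)`_(e i).
Proof.
move=> le_p; apply: (big_ind3 (fun q m c => (size q <= m.+1)%N /\ q`_m = c)).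
- by rewrite size_poly1 coef1.
- move=> q m c q' m' c' [le_q <-] [le_q' <-]; split.
    by apply: leq_trans (size_polyMleq _ _) _; lia.
  rewrite coefM (bigD1 (inord m)) //= inordK ?ltnS ?leq_addr // addKn.
  rewrite big1 ?addr0 // => j; rewrite -val_eqE /= inordK ?ltnS ?leq_addr // => neq_jm.
  case: (ltngtP j m) neq_jm => // [lt_jm|gt_jm] _.
    by rewrite [q'`__]nth_default ?mulr0 //; apply: leq_trans le_q' _; rewrite ltn_subRL addnC; lia.
  by rewrite nth_default ?mul0r //; exact: leq_trans le_q _.
- by move=> i _.
Qed.

(** Each term of the Leibniz expansion takes one entry per row, so [size_prod_leq] applies to all of
    them with the same bounds [e i]. *)
Lemma size_det_leq k (B : 'M[{poly F}]_k) (e : 'I_k -> nat) :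
    (forall i j, size (B i j) <= (e i).+1)%N ->
  (size (\det B) <= (\sum_i e i).+1)%N /\
  (\det B)`_(\sum_i e i) = \det (\matrix_(i, j) (B i j)`_(e i)).
Proof.
move=> leB; rewrite /determinant coef_sum.
have leB_s (s : 'S_k) := size_prod_leq (fun i => leB i (s i)).
split.
  apply: leq_trans (size_sum _ _ _) _; apply/bigmax_leqP => s _.
  apply: leq_trans (proj1 (leB_s s)).
  by case: (odd_perm s); rewrite ?expr1 ?expr0 ?mulN1r ?mul1r ?size_polyN.
apply: eq_bigr => s _.
have -> : \prod_i (\matrix_(i, j) (B i j)`_(e i)) i (s i) = \prod_i (B i (s i))`_(e i).
  by apply: eq_bigr => i _; rewrite mxE.
rewrite -(proj2 (leB_s s)).
by case: (odd_perm s); rewrite ?expr1 ?expr0 ?mulN1r ?mul1r ?coefN.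
Qed.

Lemma size_det_unitmx n (A : 'M[{poly F}]_n) : A \in unitmx -> size (\det A) = 1%N.
Proof. by rewrite unitmxE poly_unitE => /andP[/eqP]. Qed.

Lemma map_mx_unit (aR rR : comUnitRingType) (f : {rmorphism aR -> rR}) n
  (A : 'M[aR]_n) : A \in unitmx -> map_mx f A \in unitmx.
Proof. by rewrite !unitmxE det_map_mx; apply: rmorph_unit. Qed.

Lemma frac_mx_inj m n : injective (map_mx (@tofrac {poly F}) : 'M_(m, n) -> 'M_(m, n)).
Proof.
move=> A B /matrixP eqAB; apply/matrixP => i j.
by have := eqAB i j; rewrite !mxE => /eqP; rewrite tofrac_eq => /eqP.
Qed.

End PolynomialMatrices.

(** * Reversal of polynomials *)

Section Reversal.
Variable F : numFieldType.
Implicit Types (p q : {poly F}) (m d : nat).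

(** Describing q = lambda^m p(1/lambda) by its values makes sums, products and determinants
    immediate. The field being infinite, q is unique; the size bounds give access to
    coefficients. *)
Definition is_reversal m p q :=
  [/\ (size p <= m.+1)%N, (size q <= m.+1)%N &
      forall a, a != 0 -> q.[a] = a ^+ m * p.[a^-1]].

Lemma poly_eq0_eval p : (forall a, a != 0 -> p.[a] = 0) -> p = 0.
Proof.
move=> p0; apply/eqP/negPn/negP => nz_p.
(* In characteristic 0 the points 1, ..., [size p] are distinct and nonzero, and too many to be all
   roots of p. *)
pose rs : seq F := [seq i.+1%:R | i <- iota 0 (size p)].
have : (size rs < size p)%N.
  apply: max_poly_roots => //.
    by apply/allP => _ /mapP[i _ ->]; apply/rootP/p0; rewrite pnatr_eq0.
  rewrite map_inj_uniq ?iota_uniq // => i j /eqP.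
  by rewrite eqr_nat => /eqP[].
by rewrite size_map size_iota ltnn.
Qed.

Lemma poly_neq0_eval p : p != 0 -> exists2 a, a != 0 & p.[a] != 0.
Proof.
move=> nz_p; pose rs : seq F := [seq i.+1%:R | i <- iota 0 (size p)].
have /allPn[a rs_a npa] : ~~ all (root p) rs.
  apply/negP => roots_p; suff : (size rs < size p)%N.
    by rewrite size_map size_iota ltnn.
  apply: max_poly_roots => //.
  rewrite map_inj_uniq ?iota_uniq // => i j /eqP.
  by rewrite eqr_nat => /eqP[].
by exists a => //; case/mapP: rs_a => i _ ->; rewrite pnatr_eq0.
Qed.

Lemma is_reversal_inj m p q q' :
  is_reversal m p q -> is_reversal m p q' -> q = q'.
Proof.
move=> [_ _ Eq] [_ _ Eq']; apply/eqP; rewrite -subr_eq0; apply/eqP.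
by apply: poly_eq0_eval => a nz_a; rewrite !hornerE Eq ?Eq' ?subrr.
Qed.

Lemma is_reversal_poly m p :
  (size p <= m.+1)%N -> is_reversal m p (\poly_(k < m.+1) p`_(m - k)).
Proof.
move=> le_p; split=> [||a nz_a]; rewrite ?size_poly //.
rewrite horner_poly (horner_coef_wide _ le_p) mulr_sumr.
rewrite (reindex_inj rev_ord_inj) /=; apply: eq_bigr => i _.
have le_im : (i <= m)%N by rewrite -ltnS.
rewrite subSS subKn // exprVn mulrCA; congr (_ * _).
by rewrite expfB_cond ?(negPf nz_a) // ?andbF.
Qed.

Lemma is_reversal_coef m p q k :
  is_reversal m p q -> (k <= m)%N -> q`_k = p`_(m - k).
Proof.
move=> rev_pq le_km; have [le_p _ _] := rev_pq.
by rewrite (is_reversal_inj rev_pq (is_reversal_poly le_p)) coef_poly ltnS le_km.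
Qed.

Lemma is_reversal0 m : is_reversal m 0 0.
Proof. by split=> [||a _]; rewrite ?size_poly0 // !horner0 mulr0. Qed.

Lemma is_reversal1 : is_reversal 0 1 1.
Proof. by split=> [||a _]; rewrite ?size_poly1 // !hornerE. Qed.

Lemma is_reversalD m p q p' q' : is_reversal m p q -> is_reversal m p' q' ->
  is_reversal m (p + p') (q + q').
Proof.
move=> [le_p le_q E] [le_p' le_q' E']; split=> [||a nz_a].
- by rewrite (leq_trans (size_polyD _ _)) // geq_max le_p.
- by rewrite (leq_trans (size_polyD _ _)) // geq_max le_q.
- by rewrite !hornerE E ?E' // mulrDr.
Qed.

Lemma is_reversalM m m' p q p' q' :
  is_reversal m p q -> is_reversal m' p' q' ->
  is_reversal (m + m') (p * p') (q * q').
Proof.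
move=> [le_p le_q E] [le_p' le_q' E']; split=> [||a nz_a].
- by apply: leq_trans (size_polyMleq _ _) _; lia.
- by apply: leq_trans (size_polyMleq _ _) _; lia.
- by rewrite !hornerM E ?E' // exprD mulrACA.
Qed.

Lemma is_reversalC c : is_reversal 0 c%:P c%:P.
Proof. by split=> [||a _]; rewrite ?size_polyC_leq1 // !hornerE. Qed.

Lemma is_reversalN m p q : is_reversal m p q -> is_reversal m (- p) (- q).
Proof.
by move=> [le_p le_q E]; split=> [||a nz_a]; rewrite ?size_polyN // !hornerE E // mulrN.
Qed.

Lemma is_reversalXn m i : (i <= m)%N -> is_reversal m 'X^i 'X^(m - i).
Proof.
move=> le_im; split=> [||a nz_a]; rewrite ?size_polyXn ?ltnS ?leq_subr //.
by rewrite !hornerE exprVn expfB_cond // (negPf nz_a).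
Qed.

Lemma is_reversal_sum m (I : Type) (r : seq I) (P : pred I) (p q : I -> {poly F}) :
  (forall i, P i -> is_reversal m (p i) (q i)) ->
  is_reversal m (\sum_(i <- r | P i) p i) (\sum_(i <- r | P i) q i).
Proof.
move=> rev_pq; elim/big_ind2: _ => // [|*]; first exact: is_reversal0.
exact: is_reversalD.
Qed.

Lemma is_reversal_prod (I : Type) (r : seq I) (P : pred I) (m : I -> nat)
    (p q : I -> {poly F}) :
  (forall i, P i -> is_reversal (m i) (p i) (q i)) ->
  is_reversal (\sum_(i <- r | P i) m i) (\prod_(i <- r | P i) p i)
    (\prod_(i <- r | P i) q i).
Proof.
move=> rev_pq; apply: (big_ind3 (fun k => is_reversal k)) => //.
  exact: is_reversal1.
by move=> *; apply: is_reversalM.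
Qed.

Lemma is_reversal_det k m (P Q : 'M[{poly F}]_k) :
  (forall i j, is_reversal m (P i j) (Q i j)) ->
  is_reversal (k * m) (\det P) (\det Q).
Proof.
move=> revPQ; apply: is_reversal_sum => s _.
have -> : (k * m = 0 + \sum_(i < k) m)%N by rewrite sum_nat_const card_ord.
apply: is_reversalM; last by apply: is_reversal_prod => i _.
case: (odd_perm s); rewrite ?expr1 ?expr0; last exact: is_reversal1.
exact/is_reversalN/is_reversal1.
Qed.

(** Each term [L x i * D i j * R j y] is reversed in grade a i + e + b j. Zero entries of D are
    exempted because a i + b j may exceed m there. *)
Lemma is_reversal_mulmx (r n n' m : nat) (a b : 'I_r -> nat)
    (L L' : 'M[{poly F}]_(n, r)) (R R' : 'M[{poly F}]_(r, n')) (D D' : 'M[{poly F}]_r) :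
    (forall x i, is_reversal (a i) (L x i) (L' x i)) ->
    (forall i y, is_reversal (b i) (R i y) (R' i y)) ->
    (forall i j, D i j = 0 /\ D' i j = 0 \/
       exists2 e, (a i + e + b j = m)%N & is_reversal e (D i j) (D' i j)) ->
  forall x y, is_reversal m ((L *m D *m R) x y) ((L' *m D' *m R') x y).
Proof.
move=> revL revR revD x y; rewrite !mxE; apply: is_reversal_sum => j _.
rewrite !mxE !mulr_suml; apply: is_reversal_sum => i _.
have [[-> ->]|[e <- revDij]] := revD i j.
  by rewrite !mulr0 !mul0r; apply: is_reversal0.
by do 2?apply: is_reversalM.
Qed.

End Reversal.

(** * Minimal bases *)

Section MinimalBases.
Variable F : closedFieldType.

Lemma size_row_degree k n (B : 'M[{poly F}]_(k, n)) i j :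
  (size (B i j) <= (row_degree B i).+1)%N.
Proof.
have := leq_bigmax j (F := fun j => (size (B i j)).-1).
rewrite -/(row_degree B i); lia.
Qed.

Lemma size_minor_leq k n (B : 'M[{poly F}]_(k, n)) (g : 'I_k -> 'I_n) :
  (size (\det (colsub g B)) <= (\sum_i row_degree B i).+1)%N.
Proof.
apply: (proj1 (size_det_leq (e := row_degree B) _)) => i j.
by rewrite mxE size_row_degree.
Qed.

(** This is the highest row degree coefficient matrix; B is called row reduced when it has full row
    rank. *)
Definition leading_row_mx k n (B : 'M[{poly F}]_(k, n)) : 'M[F]_(k, n) :=
  \matrix_(i, j) (B i j)`_(row_degree B i).

(** At the sum of the row degrees, the coefficient of a maximal minor of B is the same minor of
    [leading_row_mx B]. *)
Lemma reduced_minor k n (B : 'M[{poly F}]_(k, n)) : row_free (leading_row_mx B) ->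
  exists g : 'I_k -> 'I_n, size (\det (colsub g B)) = (\sum_i row_degree B i).+1.
Proof.
move=> /row_free_minor[g nz_g]; exists g; apply/eqP; rewrite eqn_leq size_minor_leq /=.
have leB i j : (size (colsub g B i j) <= (row_degree B i).+1)%N.
  by rewrite mxE size_row_degree.
have [_ coef_det] := size_det_leq leB.
rewrite ltnNge; apply: contra nz_g => /leq_sizeP/(_ _ (leqnn _)); rewrite coef_det.
by move=> /eqP; congr (\det _ == 0); apply/matrixP => i j; rewrite !mxE.
Qed.

Lemma row_free_fracMunit k n (T : 'M[{poly F}]_k) (B : 'M[{poly F}]_(k, n)) :
  T \in unitmx -> row_free (frac_mx (T *m B)) = row_free (frac_mx B).
Proof.
move=> unitT; rewrite /row_free /frac_mx map_mxM eqmxMfull //.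
by rewrite row_full_unit; apply: map_mx_unit.
Qed.

(* A constant relation c between the leading rows, applied with compensating
   powers of 'X to a row of largest degree i among those with c_i != 0, lowers
   the degree of row i and leaves the others unchanged. *)
Lemma row_reduction_step k n (B : 'M[{poly F}]_(k, n)) :
    row_free (frac_mx B) -> ~~ row_free (leading_row_mx B) ->
  exists2 T : 'M[{poly F}]_k, T \in unitmx &
    (\sum_i row_degree (T *m B) i < \sum_i row_degree B i)%N.
Proof.
move=> freeB; rewrite -kermx_eq0 => /rowV0Pn[c /sub_kermxP c_lead nz_c].
have [i0 nz_ci0] : exists i0, c 0 i0 != 0.
  apply/existsP; apply: contraR nz_c; rewrite negb_exists => /forallP c0.
  by apply/eqP/rowP => i; rewrite mxE; apply/eqP; rewrite -[_ == _]negbK.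
pose i := [arg max_(i > i0 | c 0 i != 0) row_degree B i].
have [nz_ci max_i] : c 0 i != 0 /\
    forall j, c 0 j != 0 -> (row_degree B j <= row_degree B i)%N.
  by rewrite /i; case: arg_maxnP.
pose T : 'M[{poly F}]_k := \matrix_(x, y)
  if x == i then c 0 y *: 'X^(row_degree B i - row_degree B y) else (x == y)%:R.
(* T differs from the identity in row i only, so the cofactors along that row are those of the
   identity and the determinant is the constant c_i. *)
have unitT : T \in unitmx.
  have cofT j : cofactor T i j = (i == j)%:R.
    transitivity (\adj (1%:M : 'M[{poly F}]_k) j i); last by rewrite adj1 mxE eq_sym.
    rewrite mxE /cofactor; congr (_ * \det _).
    by apply/matrixP => x y; rewrite !mxE eq_sym (negPf (neq_lift _ _)).
  rewrite unitmxE (expand_det_row T i) (bigD1 i) //= cofT eqxx mulr1.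
  rewrite big1 ?addr0 => [|j /negPf ne_ji]; last first.
    by rewrite cofT eq_sym ne_ji mulr0.
  by rewrite mxE eqxx subnn expr0 alg_polyC poly_unitE size_polyC nz_ci coefC unitfE.
exists T => //.
have TB x j : x != i -> (T *m B) x j = B x j.
  move=> /negPf ne_xi; rewrite mxE (bigD1 x) //= mxE ne_xi eqxx mul1r.
  rewrite big1 ?addr0 // => y /negPf ne_yx.
  by rewrite mxE ne_xi eq_sym ne_yx mul0r.
have TBi j : (size ((T *m B) i j) <= row_degree B i)%N.
  apply/leq_sizeP => m le_m; rewrite mxE coef_sum.
  case: (ltngtP (row_degree B i) m) le_m => // [lt_m|eq_m] _.
    apply: big1 => y _; rewrite mxE eqxx -scalerAl coefZ.
    have [->|nz_cy] := eqVneq (c 0 y) 0; first by rewrite mul0r.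
    rewrite coefXnM; case: ifP => _; first exact: mulr0.
    rewrite nth_default ?mulr0 //.
    apply: leq_trans (size_row_degree B y j) _.
    by have := max_i _ nz_cy; lia.
  have /rowP/(_ j) := c_lead; rewrite [RHS]mxE; apply: etrans.
  rewrite mxE; apply: eq_bigr => y _; rewrite !mxE eqxx -scalerAl coefZ.
  have [->|nz_cy] := eqVneq (c 0 y) 0; first by rewrite !mul0r.
  rewrite coefXnM -eq_m ltnNge leq_subr /= subKn //; exact: max_i.
have degi : (row_degree (T *m B) i < row_degree B i)%N.
  (* A degree 0 cannot decrease, a zero row having [row_degree] 0 too. But then row i would become
     zero, against the freeness of the rows. *)
  have [di0|di_gt0] := posnP (row_degree B i).
    have := freeB; rewrite -(row_free_fracMunit _ unitT) => /row_free_inj inj.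
    have /inj/rowP/(_ i) : delta_mx 0 i *m frac_mx (T *m B) = (0 : 'rV_k) *m frac_mx (T *m B).
      apply/rowP => j; rewrite -rowE mul0mx !mxE.
      have := TBi j; rewrite di0 leqn0 size_poly_eq0 mxE => /eqP ->.
      exact: rmorph0.
    by move/eqP; rewrite !mxE !eqxx oner_eq0.
  rewrite -(prednK di_gt0) ltnS; apply/bigmax_leqP => j _.
  by rewrite -!subn1 leq_sub2r // TBi.
rewrite (bigD1 i) //= [X in (_ < X)%N](bigD1 i) //=.
rewrite -addSn leq_add // leq_eqVlt; apply/orP; left; apply/eqP.
by apply: eq_bigr => x ne_xi; apply: eq_bigr => j _; rewrite TB.
Qed.

Lemma row_reduction k n (B : 'M[{poly F}]_(k, n)) : row_free (frac_mx B) ->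
  exists2 T : 'M[{poly F}]_k, T \in unitmx & row_free (leading_row_mx (T *m B)).
Proof.
have [m] := ubnP (\sum_i row_degree B i); elim: m B => // m IHm B ltBm freeB.
have [?|nfree] := boolP (row_free (leading_row_mx B)).
  by exists 1%:M; rewrite ?unitmx1 // mul1mx.
have [T unitT lt_deg] := row_reduction_step freeB nfree.
have [|S unitS freeS] := IHm (T *m B) (leq_trans lt_deg ltBm).
  by rewrite row_free_fracMunit.
by exists (S *m T); rewrite ?unitmx_mul ?unitS // -mulmxA.
Qed.

Section Comparison.
Variables (n k : nat) (V : 'M[{fraction {poly F}}]_n).
Variables (B : 'M[{poly F}]_(k, n)) (C : 'M[{poly F}]_(n, k)).
Hypotheses (basisB : polynomial_basis V B) (BC : B *m C = 1%:M).

(** The coordinates of B' in the basis B are a priori rational functions; the right inverse C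
    identifies them with the polynomial matrix B' C. *)
Lemma polynomial_basis_comparison (B' : 'M[{poly F}]_(k, n)) :
  polynomial_basis V B' -> exists2 T : 'M[{poly F}]_k, B' = T *m B & \det T != 0.
Proof.
case: basisB => [freeB /eqmxP eqB] [freeB' /eqmxP eqB'].
have /submxP[X B'E] : (frac_mx B' <= frac_mx B)%MS by rewrite eqB' eqB.
have XE : X = frac_mx (B' *m C).
  by rewrite /frac_mx map_mxM [map_mx _ B']B'E -mulmxA -map_mxM BC map_mx1 mulmx1.
have B'T : B' = B' *m C *m B.
  by apply: (@frac_mx_inj F); rewrite map_mxM -[map_mx _ (_ *m C)]XE.
exists (B' *m C) => //.
have : frac_mx (B' *m C) \in unitmx.
  rewrite -row_free_unit -row_leq_rank.
  rewrite -{1}(eqP freeB') {1}B'T /frac_mx map_mxM; exact: mxrankM_maxl.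
by rewrite unitmxE det_map_mx unitfE tofrac_eq0.
Qed.

(** Another basis has the maximal minors of B times a fixed nonzero polynomial, so the degree of the
    minor g is a lower bound for every row degree sum. *)
Lemma minimal_basis_criterion (g : 'I_k -> 'I_n) :
  size (\det (colsub g B)) = (\sum_i row_degree B i).+1 -> minimal_basis V B.
Proof.
move=> size_g; split=> // B' /polynomial_basis_comparison[T -> nzT].
rewrite -ltnS -size_g; apply: leq_trans (size_minor_leq _ g).
rewrite det_colsub_mul size_mul //; last by rewrite -size_poly_eq0 size_g.
by move: nzT; rewrite -size_poly_gt0; case: (size _) => // m _; rewrite leq_addl.
Qed.

(** A unimodular row reduction of B keeps the degrees of the maximal minors and makes their largest
    degree equal to its row degree sum. This sum is minimal, hence that of N. *)
Lemma minimal_basis_minors (N : 'M[{poly F}]_(k, n)) (m := (\sum_i row_degree N i)%N) :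
    minimal_basis V N ->
  (forall g : 'I_k -> 'I_n, (size (\det (colsub g B)) <= m.+1)%N) /\
  exists g : 'I_k -> 'I_n, size (\det (colsub g B)) = m.+1.
Proof.
case=> basisN minN; have [freeB eqB] := basisB.
have [T unitT redTB] := row_reduction freeB.
have sizeT (g : 'I_k -> 'I_n) : size (\det (colsub g (T *m B))) = size (\det (colsub g B)).
  have sT := size_det_unitmx unitT; rewrite det_colsub_mul.
  have [->|nz_g] := eqVneq (\det (colsub g B)) 0; first by rewrite mulr0.
  by rewrite size_mul ?sT // -size_poly_eq0 sT.
suff <- : (\sum_i row_degree (T *m B) i = m)%N.
  split=> [g|]; first by rewrite -sizeT size_minor_leq.
  by have [g size_g] := reduced_minor redTB; exists g; rewrite -sizeT.
apply/eqP; rewrite eqn_leq; apply/andP; split; last first.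
  apply: minN; split; first by rewrite row_free_fracMunit.
  apply/eqmxP/(eqmx_trans _ (eqmxP eqB)); rewrite /frac_mx map_mxM.
  by apply: eqmxMfull; rewrite row_full_unit; apply: map_mx_unit.
have [S NE nzS] := polynomial_basis_comparison basisN.
have [g size_g] := reduced_minor redTB.
rewrite -ltnS -size_g sizeT; apply: leq_trans (size_minor_leq N g).
rewrite NE det_colsub_mul size_mul //; last by rewrite -size_poly_eq0 -sizeT size_g.
by move: nzS; rewrite -size_poly_gt0; case: (size _) => // l _; rewrite leq_addl.
Qed.

End Comparison.

Lemma polynomial_basis_kermx n k r (P : 'M[{poly F}]_n) (B : 'M[{poly F}]_(k, n)) :
    mxpoly_rank P = r -> (r + k)%N = n -> row_free (frac_mx B) -> B *m P^T = 0 ->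
  polynomial_basis (kermx (frac_mx P)^T) B.
Proof.
move=> rankP nE freeB BP0; split=> //.
have leBK : (frac_mx B <= kermx (frac_mx P)^T)%MS.
  by apply/sub_kermxP; rewrite /frac_mx map_trmx -map_mxM BP0 map_mx0.
have := mxrank_leqif_eq leBK => /leqifP; case: ifP => // _.
by rewrite (eqP freeB) mxrank_ker mxrank_tr -/(mxpoly_rank P) rankP -nE addKn ltnn.
Qed.

Lemma row_free_right_inverse k n (B : 'M[{poly F}]_(k, n)) (C : 'M_(n, k)) :
  B *m C = 1%:M -> row_free (frac_mx B).
Proof.
move=> BC; rewrite -row_leq_rank -{1}(mxrank1 {fraction {poly F}} k).
rewrite -(map_mx1 (@tofrac {poly F})) -BC map_mxM; exact: mxrankM_maxl.
Qed.

End MinimalBases.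

(** * Elementary divisors and invariant polynomials *)

Section ElementaryDivisors.
Variable F : closedFieldType.
Implicit Types (g : {poly F}) (a : F).

Lemma prime_power_factorsE g : g \is monic ->
  exists2 rs : seq F, g = \prod_(z <- rs) ('X - z%:P) &
    prime_power_factors g = [seq ('X - a%:P) ^+ mup a g | a <- undup rs].
Proof.
rewrite /prime_power_factors /poly_roots => mon_g.
case: (closed_field_poly_normal g) => rs /= gE; exists rs => //.
by rewrite {1}gE (monicP mon_g) scale1r.
Qed.

Lemma prod_prime_power_factors g :
  g \is monic -> \prod_(q <- prime_power_factors g) q = g.
Proof.
move=> /prime_power_factorsE[rs -> ->]; rewrite big_map.
by under eq_bigr do rewrite mu_prod_XsubC; rewrite prodr_undup_exp_count.
Qed.

Lemma root_prime_power_factors g a : g \is monic ->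
  [seq q <- prime_power_factors g | root q a] =
  if root g a then [:: ('X - a%:P) ^+ mup a g] else [::].
Proof.
move=> /prime_power_factorsE[rs gE ->]; rewrite filter_map.
have -> : root g a = (a \in undup rs) by rewrite gE root_prod_XsubC mem_undup.
have -> : [seq b <- undup rs | preim (fun b => ('X - b%:P) ^+ mup b g) (root^~ a) b] =
          [seq b <- undup rs | pred1 a b].
  apply: eq_in_filter => b; rewrite mem_undup => rs_b /=.
  have : (0 < mup b g)%N by rewrite gE mu_prod_XsubC -has_count has_pred1.
  by case: (mup b g) => // m _; rewrite root_exp_XsubC eq_sym.
case: ifP => [rs_a|/negbT nrs_a]; first by rewrite filter_pred1_uniq ?undup_uniq.
rewrite (_ : filter _ _ = [::]) //; apply/eqP; rewrite -size_eq0 size_filter.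
by rewrite -leqn0 leqNgt -has_count has_pred1.
Qed.

Lemma prime_power_factors1 : prime_power_factors (1 : {poly F}) = [::].
Proof.
have [rs rs1 ->] := prime_power_factorsE (monic1 F).
by have := size_prod_XsubC rs id; rewrite -rs1 size_poly1 => -[/esym/size0nil->].
Qed.

Lemma prime_power_factors_simple (mu : seq F) : uniq mu ->
  perm_eq (prime_power_factors (\prod_(m <- mu) ('X - m%:P)))
    [seq 'X - m%:P | m <- mu].
Proof.
move=> uniq_mu; have mon := monic_prod_XsubC mu xpredT id.
have [rs gE ->] := prime_power_factorsE mon.
have eq_rs : undup rs =i mu.
  by move=> z; rewrite mem_undup -root_prod_XsubC -gE root_prod_XsubC.
have : perm_eq (undup rs) mu by rewrite uniq_perm ?undup_uniq.
move=> /(perm_map (fun a => 'X - a%:P)) perm_rs; apply: perm_trans perm_rs.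
rewrite (_ : map _ _ = [seq 'X - a%:P | a <- undup rs]) //.
apply/eq_in_map => a; rewrite eq_rs => mu_a.
by rewrite mu_prod_XsubC count_uniq_mem // mu_a expr1.
Qed.

Lemma prod_elementary_divisors (gs L : seq {poly F}) :
    all (fun g => g \is monic) gs ->
    perm_eq (flatten [seq prime_power_factors g | g <- gs]) L ->
  \prod_(g <- gs) g = \prod_(q <- L) q.
Proof.
move=> /allP mon_gs /(perm_big _) <-; rewrite big_flatten big_map.
by rewrite !big_seq; apply: eq_bigr => g /mon_gs/prod_prime_power_factors.
Qed.

(** An invariant polynomial vanishing at a has exactly one elementary divisor there, whose exponent
    is the multiplicity of a. *)
Lemma simple_elementary_divisors_at a n (P : 'M[{poly F}]_n) t :
    elementary_divisors_at a P (nseq t ('X - a%:P)) ->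
  exists gs : seq {poly F}, [/\ invariant_polynomials P gs,
    count (root^~ a) gs = t & {in gs, forall g, mup a g = root g a}].
Proof.
case=> L' [[gs [inv_gs /(perm_filter (root^~ a)) perm_gs]] /(perm_trans perm_gs)].
have [_ /allP mon_gs _ _] := inv_gs.
have -> : [seq q <- flatten [seq prime_power_factors g | g <- gs] | root q a] =
  [seq ('X - a%:P) ^+ mup a g | g <- gs & root g a].
  elim: gs mon_gs {inv_gs perm_gs} => //= g gs IHgs mon_gs.
  rewrite filter_cat root_prime_power_factors ?mon_gs ?mem_head //.
  rewrite IHgs => [|h gs_h]; first by case: ifP.
  by rewrite mon_gs // inE gs_h orbT.
move=> perm_t; exists gs; split=> //.
  by rewrite -[RHS](size_nseq t ('X - a%:P)) -(perm_size perm_t) size_map size_filter.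
move=> g gs_g; have [ga0|/mupNroot //] := boolP (root g a).
have : ('X - a%:P) ^+ mup a g \in nseq t ('X - a%:P).
  by rewrite -(perm_mem perm_t); apply/mapP; exists g; rewrite // mem_filter ga0.
rewrite mem_nseq => /andP[_ /eqP/(congr1 (fun q : {poly F} => size q))].
by rewrite size_exp_XsubC size_XsubC => -[].
Qed.

Lemma sum_nth_default n (gs : seq {poly F}) (c : pred {poly F}) :
  (size gs <= n)%N -> ~~ c 0 -> (\sum_(i < n) (c (gs`_i)%R : nat) = count c gs)%N.
Proof.
move=> le_gs /negPf c0; rewrite -sum1_count (big_nth 0) big_mkord.
rewrite (big_ord_widen_cond n (fun i => c gs`_i) (fun=> 1%N)) //.
rewrite [RHS]big_mkcond /=; apply: eq_bigr => i _.
case: ltnP => [_|le_i]; first by rewrite andbT; case: (c _).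
by rewrite nth_default // c0.
Qed.

(** U and V stay invertible at a, so the rank is the number of diagonal entries nonzero at a; the
    zeros that pad the diagonal do not count. *)
Lemma rank_eval_invariant_polynomials n (P : 'M[{poly F}]_n) gs a :
    invariant_polynomials P gs ->
  \rank (map_mx (horner_eval a) P) = count (fun g => ~~ root g a) gs.
Proof.
case=> le_gs _ _ [U [V [unitU unitV]]].
move=> /(congr1 (map_mx (horner_eval a))); rewrite !map_mxM => /(congr1 mxrank).
rewrite mxrankMfree ?row_free_unit ?map_mx_unit //.
rewrite eqmxMfull ?row_full_unit ?map_mx_unit // => ->.
rewrite map_diag_mx rank_diag_mx.
rewrite -(sum_nth_default (c := fun g => ~~ root g a) le_gs) ?root0 //.
by apply: eq_bigr => i _; rewrite !mxE rootE.
Qed.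

Lemma rank_invariant_polynomials n (P : 'M[{poly F}]_n) gs :
  invariant_polynomials P gs -> mxpoly_rank P = size gs.
Proof.
case=> le_gs /allP mon_gs _ [U [V [unitU unitV]]].
move=> /(congr1 (map_mx (@tofrac {poly F}))); rewrite !map_mxM => /(congr1 mxrank).
rewrite mxrankMfree ?row_free_unit ?map_mx_unit //.
rewrite eqmxMfull ?row_full_unit ?map_mx_unit // => /= rankP.
rewrite /mxpoly_rank /frac_mx rankP.
rewrite map_diag_mx rank_diag_mx.
transitivity (\sum_(i < n) ((gs`_i)%R != 0%R : nat))%N.
  by apply: eq_bigr => i _; rewrite !mxE tofrac_eq0.
rewrite (sum_nth_default (c := fun g => g != 0) le_gs) ?eqxx //.
by apply/eqP; rewrite -all_count; apply/allP => g /mon_gs/monic_neq0.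
Qed.

End ElementaryDivisors.

(** * Smith form of diagonal matrices with pairwise coprime entries *)

Section CoprimeDiagonal.
Variable R : comUnitRingType.

Definition mx_equivalent n (A B : 'M[R]_n) :=
  exists U V : 'M[R]_n, [/\ U \in unitmx, V \in unitmx & U *m A *m V = B].

Lemma mx_equivalent_refl n (A : 'M[R]_n) : mx_equivalent A A.
Proof. by exists 1%:M, 1%:M; rewrite !unitmx1 mul1mx mulmx1. Qed.

Lemma mx_equivalent_trans n (A B C : 'M[R]_n) :
  mx_equivalent A B -> mx_equivalent B C -> mx_equivalent A C.
Proof.
move=> [U [V [uU uV <-]]] [U' [V' [uU' uV' <-]]]; exists (U' *m U), (V *m V').
by rewrite !unitmx_mul uU uV uU' uV' !mulmxA.
Qed.

Lemma transvection_unit n (i j : 'I_n) (x : R) :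
  i != j -> 1%:M + x *: delta_mx i j \in unitmx.
Proof.
move=> /negPf ne_ij; suff /mulmx1_unit[] :
  (1%:M + x *: delta_mx i j) *m (1%:M - x *: delta_mx i j) = 1%:M by [].
rewrite mulmxBr !mulmxDl !mul1mx mulmx1 -scalemxAl -scalemxAr mul_delta_mx_cond.
by rewrite eq_sym ne_ij mulr0n !scaler0 addr0 addrK.
Qed.

(* The 2 x 2 identity behind the choice of U and V is
   diag(a, b) -> [[0, - a b], [1, 0]] by four transvections when u a + v b = 1,
   followed by a signed swap of the two rows. *)
Lemma diag_mx_coprime2 n (d : 'rV[R]_n) (i j : 'I_n) (u v : R) :
    i != j -> u * d 0 i + v * d 0 j = 1 ->
  mx_equivalent (diag_mx d)
    (diag_mx (\row_x if x == i then 1 else if x == j then d 0 i * d 0 j else d 0 x)).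
Proof.
move=> ne_ij; have /negPf ne_ji : j != i by rewrite eq_sym.
set a := d 0 i; set b := d 0 j => bez; have /negPf nij := ne_ij.
(* With the entries at i and j cleared, E kills the matrix units at i and j, and only a 2 x 2
   computation remains. *)
pose e : 'rV[R]_n := \row_x if (x == i) || (x == j) then 0 else d 0 x.
pose E := diag_mx e.
have eE : diag_mx d = E + a *: delta_mx i i + b *: delta_mx j j.
  apply/matrixP => x y; rewrite !mxE; case: (eqVneq x y) => [<-|ne_xy] /=.
    have [->|nxi] := eqVneq x i; first by rewrite nij /= !mulr1n mulr1 mulr0 add0r addr0.
    have [->|nxj] := eqVneq x j; first by rewrite /= !mulr1n mulr1 mulr0 addr0 add0r.
    by rewrite /= !mulr0 !addr0.
  have ne2 z : (x == z) && (y == z) = false.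
    by apply/negP => /andP[/eqP xz /eqP yz]; rewrite xz yz eqxx in ne_xy.
  by rewrite !ne2 !mulr0n !mulr0 !addr0.
have dE (x y : 'I_n) : delta_mx x y *m E = e 0 y *: delta_mx x y.
  apply/matrixP => z w; rewrite mul_mx_diag !mxE [in RHS]mulrC.
  by have [->|/negPf nwy] := eqVneq w y; rewrite // andbF !mul0r.
have Ed (x y : 'I_n) : E *m delta_mx x y = e 0 x *: delta_mx x y.
  apply/matrixP => z w; rewrite mul_diag_mx !mxE.
  by have [->|/negPf nwy] := eqVneq z x; rewrite // !mulr0.
have ei : e 0 i = 0 by rewrite mxE eqxx.
have ej : e 0 j = 0 by rewrite mxE eqxx orbT.
pose S : 'M[R]_n := 1%:M - delta_mx i i - delta_mx j j + delta_mx i j - delta_mx j i.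
have unitS : S \in unitmx.
  suff /mulmx1_unit[] : S *m (1%:M - delta_mx i i - delta_mx j j - delta_mx i j + delta_mx j i) = 1%:M by [].
  rewrite /S !(mulmxDl, mulmxDr, mulmxBl, mulmxBr, mulNmx, mulmxN, mul1mx, mulmx1).
  rewrite ?mul_delta_mx_cond ?eqxx ?nij ?ne_ji !(mulr1n, mulr0n).
  by apply/matrixP => x y; rewrite !mxE; ring.
exists (S *m (1%:M + (- a) *: delta_mx i j) *m (1%:M + u *: delta_mx j i)),
  ((1%:M + v *: delta_mx j i) *m (1%:M + (- b) *: delta_mx i j)).
rewrite !unitmx_mul unitS !transvection_unit ?ne_ji //; split=> //.
have dEi (x : 'I_n) : delta_mx x i *m E = 0 by rewrite dE ei scale0r.
have dEj (x : 'I_n) : delta_mx x j *m E = 0 by rewrite dE ej scale0r.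
have Edi (x : 'I_n) : E *m delta_mx i x = 0 by rewrite Ed ei scale0r.
have Edj (x : 'I_n) : E *m delta_mx j x = 0 by rewrite Ed ej scale0r.
clearbody E.
pose dd := (dEi, dEj, Edi, Edj).
have expand (A B : 'M[R]_n) (x : R) (k l : 'I_n) :
  ((1%:M + x *: delta_mx k l) *m A = A + x *: (delta_mx k l *m A)) *
  (A *m (1%:M + x *: delta_mx k l) = A + x *: (A *m delta_mx k l)).
  by rewrite mulmxDl mulmxDr mul1mx mulmx1 -scalemxAl -scalemxAr.
pose arith := (mulmxDl, mulmxDr, mulmxBl, mulmxBr, mulNmx, mulmxN, mul1mx, mulmx1, dd).
have mulZl (x : R) (A B : 'M[R]_n) : (x *: A) *m B = x *: (A *m B) by rewrite scalemxAl.
have mulZr (x : R) (A B : 'M[R]_n) : A *m (x *: B) = x *: (A *m B) by rewrite scalemxAr.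
pose deltas := (mulZl, mulZr, mul_delta_mx_cond, eqxx, nij, ne_ji, mulr1n,
  mulr0n, mul0mx, mulmx0, scaler0).
have step1 : (1%:M + u *: delta_mx j i) *m diag_mx d *m (1%:M + v *: delta_mx j i) =
   E + a *: delta_mx i i + b *: delta_mx j j + delta_mx j i.
  rewrite eE ?arith ?deltas ?arith ?deltas.
  have bez1 c : c = (u * a + v * b) * c by rewrite bez mul1r.
  by apply/matrixP => x y; rewrite !mxE [X in _ = _ + X]bez1; ring.
have step2 : (1%:M + (- a) *: delta_mx i j) *m
    (E + a *: delta_mx i i + b *: delta_mx j j + delta_mx j i) *m
    (1%:M + (- b) *: delta_mx i j) = E + delta_mx j i - (a * b) *: delta_mx i j.
  rewrite ?arith ?deltas ?arith ?deltas.
  by apply/matrixP => x y; rewrite !mxE; ring.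
transitivity (S *m (E + delta_mx j i - (a * b) *: delta_mx i j)).
  by rewrite -step2 -step1 !mulmxA.
rewrite /S ?arith ?deltas ?arith ?deltas.
have -> : diag_mx (\row_x if x == i then 1 else if x == j then a * b else d 0 x) =
    diag_mx d + (1 - a) *: delta_mx i i + (a * b - b) *: delta_mx j j.
  apply/matrixP => x y; rewrite !mxE; case: (eqVneq x y) => [<-|ne_xy] /=.
    have [->|nxi] := eqVneq x i; first by rewrite ?nij /= -/a; ring.
    by have [->|nxj] := eqVneq x j; rewrite ?ne_ji /= -?/b; ring.
  have ne2 z : (x == z) && (y == z) = false.
    by apply/negP => /andP[/eqP xz /eqP yz]; rewrite xz yz eqxx in ne_xy.
  by rewrite !ne2 !mulr0n !mulr0 !addr0.
by rewrite eE; apply/matrixP => x y; rewrite !mxE; ring.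
Qed.

End CoprimeDiagonal.

Section InvariantPolynomials.
Variable F : closedFieldType.

(** The entries of l are merged into position j one at a time; the product accumulated there stays
    coprime to the next entry. *)
Lemma diag_mx_coprime n (d : 'rV[{poly F}]_n) (j : 'I_n) (l : seq 'I_n) :
    uniq l -> j \notin l ->
    (forall x y, x != y -> coprimep (d 0 x) (d 0 y)) ->
  mx_equivalent (diag_mx d) (diag_mx (\row_x
    if x \in l then 1 else if x == j then d 0 j * \prod_(i <- l) d 0 i else d 0 x)).
Proof.
move=> uniq_l nlj cop_d; elim: l uniq_l nlj => [|i l IHl] /=.
  move=> _ _; rewrite (_ : \row_x _ = d); first exact: mx_equivalent_refl.
  by apply/rowP => x; rewrite !mxE big_nil mulr1; case: eqP => [->|].
case/andP => nli uniq_l; rewrite inE negb_or => /andP[ne_ji nlj].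
apply: mx_equivalent_trans (IHl uniq_l nlj) _; set d1 := \row_x _.
have d1i : d1 0 i = d 0 i by rewrite mxE (negPf nli) eq_sym (negPf ne_ji).
have d1j : d1 0 j = d 0 j * \prod_(i <- l) d 0 i by rewrite mxE (negPf nlj) eqxx.
have ne_ij : i != j by rewrite eq_sym.
have : coprimep (d1 0 i) (d1 0 j).
  rewrite d1i d1j coprimepMr cop_d //= big_seq; elim/big_ind: _ => [||x lx].
  - exact: coprimep1.
  - by move=> p q cop_p cop_q; rewrite coprimepMr cop_p.
  - by apply: cop_d; apply: contraNneq nli => ->.
case/Bezout_eq1_coprimepP => -[u v] /= bez.
rewrite [X in mx_equivalent _ X](_ : _ = diag_mx (\row_x if x == i then 1 else
    if x == j then d1 0 i * d1 0 j else d1 0 x)); first exact: diag_mx_coprime2 bez.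
congr diag_mx; apply/rowP => x; rewrite !mxE inE (negPf nli) (negPf ne_ij) (negPf nlj) eqxx.
case: (eqVneq x i) => //= _; case: (eqVneq x j) => [->|//].
by rewrite (negPf nlj) big_cons mulrCA.
Qed.

Lemma invariant_polynomials_equivalent n (A B : 'M[{poly F}]_n) gs :
  mx_equivalent A B -> invariant_polynomials B gs -> invariant_polynomials A gs.
Proof.
move=> [U [V [uU uV AB]]] [le_gs mon_gs dvd_gs [U' [V' [uU' uV' BE]]]].
split=> //; exists (U' *m U), (V *m V').
by rewrite !unitmx_mul uU uV uU' uV' -BE -AB !mulmxA.
Qed.

Lemma invariant_polynomials_coprime_diag m (d : 'rV[{poly F}]_m.+1)
    (q := \prod_i d 0 i) :
    (forall x, d 0 x != 0) -> (forall x y, x != y -> coprimep (d 0 x) (d 0 y)) ->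
  invariant_polynomials (diag_mx d) (rcons (nseq m 1) ((lead_coef q)^-1 *: q)).
Proof.
move=> nz_d cop_d; have nz_q : q != 0 by apply/prodf_neq0 => x _.
have nz_lq : lead_coef q != 0 by rewrite lead_coef_eq0.
(* Gathering the product at the last position puts the ones first, as the divisibility chain
   requires. *)
set g := _ *: q; pose l := [seq x <- enum 'I_m.+1 | x != ord_max].
have nl_max : ord_max \notin l by rewrite mem_filter eqxx.
have eq_d := diag_mx_coprime (filter_uniq _ (enum_uniq _)) nl_max cop_d.
apply: invariant_polynomials_equivalent eq_d _.
have qE : d 0 ord_max * \prod_(i <- l) d 0 i = q.
  by rewrite big_filter big_enum_cond /q [RHS](bigD1 ord_max).
split.
- by rewrite size_rcons size_nseq.
- rewrite all_rcons all_nseq monic1 orbT andbT.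
  by rewrite monicE lead_coefZ mulVf.
- by elim: (m) => // -[|m'] /= sorted_g; rewrite dvd1p.
pose c : 'rV[{poly F}]_m.+1 := \row_x if x == ord_max then (lead_coef q)^-1%:P else 1.
exists (diag_mx c), 1%:M; rewrite unitmx1 mulmx1; split=> //.
  rewrite unitmxE det_diag (bigD1 ord_max) //= big1 ?mulr1 => [|x /negPf nx]; last by rewrite mxE nx.
  by rewrite mxE eqxx poly_unitE size_polyC coefC unitfE invr_eq0 nz_lq.
rewrite mulmx_diag; congr diag_mx; apply/rowP => x; rewrite !mxE.
rewrite mem_filter mem_enum andbT nth_rcons size_nseq nth_nseq.
case: (eqVneq x ord_max) => [->|ne_x] /=; first by rewrite ltnn eqxx qE mul_polyC.
suff -> : (x < m)%N by rewrite mulr1.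
by move: ne_x (ltn_ord x); rewrite -val_eqE /= ltnS leq_eqVlt => /negPf ->.
Qed.

(** The product is W^T diag(D, 0) W, which is equivalent to D bordered by zeros. *)
Lemma invariant_polynomials_congruence r k (W : 'M[{poly F}]_(r + k)) (D : 'M_r) gs :
    W \in unitmx -> invariant_polynomials D gs ->
  invariant_polynomials ((usubmx W)^T *m D *m usubmx W) gs.
Proof.
move=> unitW [le_gs mon_gs dvd_gs [U [V [uU uV DE]]]].
split=> //; first exact: leq_trans le_gs (leq_addr _ _).
have blockU (X : 'M[{poly F}]_r) : X \in unitmx -> block_mx X 0 0 (1%:M : 'M_k) \in unitmx.
  by rewrite !unitmxE det_ublock det1 mulr1.
exists (block_mx U 0 0 1%:M *m (invmx W)^T), (invmx W *m block_mx V 0 0 1%:M).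
rewrite !unitmx_mul unitmx_tr unitmx_inv unitW !blockU //; split=> //.
have -> : (usubmx W)^T *m D *m usubmx W = W^T *m block_mx D 0 0 0 *m W.
  rewrite -{3 4}[W]vsubmxK tr_col_mx mul_row_block mul_row_col.
  by rewrite !mulmx0 !addr0 mul0mx addr0.
rewrite !mulmxA -[_ *m (invmx W)^T *m W^T]mulmxA -trmx_mul mulmxV // trmx1 mulmx1.
rewrite -[_ *m W *m invmx W]mulmxA mulmxV // mulmx1 !mulmx_block.
rewrite !(mul0mx, mulmx0, mulmx1, mul1mx, addr0, add0r) DE.
by rewrite diag_mx_nth_block.
Qed.

End InvariantPolynomials.

(** * The index sum theorem *)

Section SmithMinors.
Variables (F : closedFieldType) (r k : nat) (P U V : 'M[{poly F}]_(r + k)).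
Variable gs : seq {poly F}.
Hypotheses (unitU : U \in unitmx) (unitV : V \in unitmx) (size_gs : size gs = r).
Hypothesis smithP : U *m P *m V = diag_mx (\row_(i < r + k) gs`_i).

(** At most the first r diagonal entries are nonzero, so P is a product of n x r, r x r and r x n
    matrices, and its r x r minors factor. *)
Lemma smith_minor (f g : 'I_r -> 'I_(r + k)) :
  \det (mxsub f g P) = \det (rowsub f (lsubmx (invmx U))) * \prod_(h <- gs) h *
    \det (colsub g (usubmx (invmx V))).
Proof.
have PE : P = lsubmx (invmx U) *m diag_mx (\row_(i < r) gs`_i) *m usubmx (invmx V).
  have -> : P = invmx U *m (U *m P *m V) *m invmx V.
    by rewrite !mulmxA mulVmx // mul1mx -mulmxA mulmxV // mulmx1.
  rewrite smithP diag_mx_nth_block ?size_gs // -{1}[invmx U]hsubmxK -{1}[invmx V]vsubmxK.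
  by rewrite mul_row_block mul_row_col !mulmx0 !addr0 mul0mx addr0.
rewrite {1}PE mxsub_mul [rowsub f (_ *m _)]mxsub_mul mxsub_id !det_mulmx.
rewrite det_diag (big_nth 0) big_mkord size_gs; congr (_ * _ * _).
by apply: eq_bigr => i _; rewrite mxE.
Qed.

Lemma smith_kernel : rsubmx (P *m V) = 0.
Proof.
have : U *m (P *m V) = block_mx (diag_mx (\row_(i < r) gs`_i)) 0 0 (0 : 'M_k).
  by rewrite mulmxA smithP diag_mx_nth_block ?size_gs //.
move/(congr1 (mulmx (invmx U))); rewrite mulKmx // => ->.
rewrite -[invmx U]submxK mulmx_block !mulmx0 addr0 block_mxEh row_mxKr.
by rewrite !addr0 col_mx0.
Qed.

(* The right null space is spanned by the last k columns of V, whose maximal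
   minors are, up to a nonzero constant, the complementary minors of the first
   r rows of V^-1. *)
Lemma smith_right_minors (eps : seq nat) :
    mxpoly_rank P = r -> right_minimal_indices P eps ->
  (forall g : 'I_r -> 'I_(r + k),
     (size (\det (colsub g (usubmx (invmx V)))) <= (sumn eps).+1)%N) /\
  exists g : 'I_r -> 'I_(r + k),
     size (\det (colsub g (usubmx (invmx V)))) = (sumn eps).+1.
Proof.
move=> rankP [k' [N [minN /perm_sumn sumN]]].
pose B := (rsubmx V)^T; pose C := (dsubmx (invmx V))^T.
have BC : B *m C = 1%:M.
  rewrite -trmx_mul -trmx1; congr trmx.
  have := mulVmx unitV; rewrite -{1}[invmx V]vsubmxK -{3}[V]hsubmxK mul_col_row.
  by rewrite scalar_mx_block => /eq_block_mx[].
have basisB : polynomial_basis (kermx (frac_mx P)^T) B.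
  apply: polynomial_basis_kermx rankP _ _ _ => //; first exact: row_free_right_inverse BC.
  rewrite -trmx_mul -trmx0; congr trmx; rewrite -smith_kernel.
  by rewrite -{2}[V]hsubmxK mul_mx_row row_mxKr.
have Ek : k' = k.
  have [[freeN /eqmxP eqN] _] := minN; have [freeB /eqmxP eqB] := basisB.
  by have := eqP freeN; rewrite eqN -eqB (eqP freeB).
subst k'; have := minimal_basis_minors basisB BC minN.
have -> : (\sum_i row_degree N i = sumn eps)%N.
  by rewrite -sumN sumnE big_map big_enum.
have jacobi (s : 'S_(r + k)) :
    size (\det (colsub (fun i => s (lshift k i)) (usubmx (invmx V)))) =
    size (\det (colsub (fun i => s (rshift r i)) B)).
  (* Permuting the columns of V^-1 and the rows of V by s keeps them inverse to each other, so
     Jacobi's identity reaches every choice of columns. *)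
  have VV1 : col_perm s (invmx V) *m row_perm s V = 1%:M.
    by rewrite mul_col_perm -row_permM mulVg row_perm1 mulVmx.
  have := det_ulsubmx_inverse VV1.
  have -> : ulsubmx (col_perm s (invmx V)) =
      colsub (fun i => s (lshift k i)) (usubmx (invmx V)).
    by apply/matrixP => i j; rewrite !mxE.
  have -> : drsubmx (row_perm s V) = (colsub (fun i => s (rshift r i)) B)^T.
    by apply/matrixP => i j; rewrite !mxE.
  rewrite det_tr => ->.
  have [unit_s _] := mulmx1_unit VV1; have size1 := size_det_unitmx unit_s.
  have [->|nz] := eqVneq (\det (colsub (fun i => s (rshift r i)) B)) 0.
    by rewrite mulr0.
  by rewrite size_mul ?size1 // -size_poly_eq0 size1.
(* An injective choice of columns extends to a permutation; for any other choice the minor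
   vanishes. *)
case=> le_minors [h size_h]; split=> [g|].
  have [/injectiveP inj_g|/injectiveP ninj_g] := boolP (injectiveb g).
    have [s sE] := perm_of_injections (@lshift_inj r k) inj_g.
    have -> : colsub g (usubmx (invmx V)) =
        colsub (fun i => s (lshift k i)) (usubmx (invmx V)).
      by apply/matrixP => i j; rewrite [LHS]mxE [RHS]mxE sE.
    by rewrite jacobi le_minors.
  by rewrite det_colsub_noninj // size_poly0.
have inj_h : injective h.
  apply/injectiveP; apply: contraT => /injectiveP ninj_h.
  by move: size_h; rewrite det_colsub_noninj // size_poly0.
have [s sE] := perm_of_injections (@rshift_inj r k) inj_h.
exists (fun i => s (lshift k i)); rewrite jacobi -size_h; congr (size (polyseq (\det _))).
by apply/matrixP => i j; rewrite [LHS]mxE [RHS]mxE sE.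
Qed.

Lemma row_free_usubmx (K : fieldType) (A : 'M[K]_(r + k)) :
  A \in unitmx -> row_free (usubmx A).
Proof.
move=> unitA; have -> : usubmx A = row_mx 1%:M 0 *m A.
  by rewrite -{2}[A]vsubmxK mul_row_col mul1mx mul0mx addr0.
by rewrite /row_free mxrankMfree ?row_free_unit // rank_row_mx0 mxrank1.
Qed.

(** V^-1 is invertible at a, so its first r rows stay independent there. At a = 0 this will give a
    minor of the reversal of least possible order. *)
Lemma smith_right_eval_minor a : exists g : 'I_r -> 'I_(r + k),
  (\det (colsub g (usubmx (invmx V)))).[a] != 0.
Proof.
have : map_mx (horner_eval a) (invmx V) \in unitmx by rewrite map_mx_unit ?unitmx_inv.
move=> /row_free_usubmx/row_free_minor[g nz_g]; exists g.
move: nz_g; rewrite -[X in _ -> X != 0]/(horner_eval a _) -det_map_mx.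
by congr (\det _ != 0); apply/matrixP => i j; rewrite !mxE.
Qed.

End SmithMinors.

Section SmithTranspose.
Variables (F : closedFieldType) (r k : nat) (P U V : 'M[{poly F}]_(r + k)).
Variable gs : seq {poly F}.

Lemma smith_tr : U *m P *m V = diag_mx (\row_(i < r + k) gs`_i) ->
  V^T *m P^T *m U^T = diag_mx (\row_(i < r + k) gs`_i).
Proof.
move=> smithP; rewrite -mulmxA -!trmx_mul smithP; exact: tr_diag_mx.
Qed.

(** Transposition turns the left factor of a Smith form into a right one, so that the results on V
    also serve for U. *)
Lemma det_rowsub_lsubmx_invmx (f : 'I_r -> 'I_(r + k)) :
  \det (rowsub f (lsubmx (invmx U))) = \det (colsub f (usubmx (invmx U^T))).
Proof.
by rewrite -det_tr -trmx_inv; congr (\det _); apply/matrixP => i j; rewrite !mxE.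
Qed.

End SmithTranspose.

Lemma symmetric_mxpoly_tr (F : closedFieldType) n (P : 'M[{poly F}]_n) :
  symmetric_mxpoly P -> P^T = P.
Proof.
move=> symP; apply/matrixP => i j; apply/polyP => l.
by have /matrixP/(_ i j) := symP l; rewrite !mxE.
Qed.

Section IndexSum.
Variable F : numClosedFieldType.
Implicit Types (gs : seq {poly F}) (mu : seq F) (eps : seq nat).

Lemma mup_prod (a : F) gs : all (fun g => g != 0) gs ->
  mup a (\prod_(g <- gs) g) = (\sum_(g <- gs) mup a g)%N.
Proof.
elim: gs => [|g gs IHgs] /=; first by rewrite !big_nil mupNroot // root1.
case/andP=> nz_g nz_gs; rewrite !big_cons mupM ?IHgs //.
by rewrite prodf_seq_neq0; apply: sub_all nz_gs => h ->.
Qed.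

Lemma mup_factor (a : F) (p : {poly F}) : p != 0 ->
  exists2 q, ~~ root q a & p = q * ('X - a%:P) ^+ mup a p.
Proof.
move=> nz_p; have [m [q /implyP/(_ nz_p) nqa pE]] := multiplicity_XsubC p a.
by exists q => //; rewrite {2}pE mupMr // mup_XsubCX eqxx.
Qed.

Section Reversal.
Variables (n d : nat) (P : 'M[{poly F}]_n).
Hypothesis gradeP : has_grade P d.

Lemma is_reversal_mx i j : is_reversal d (P i j) (rev_mxpoly d P i j).
Proof.
rewrite mxE; apply: is_reversal_poly; apply/leq_sizeP => m lt_dm.
by have /matrixP/(_ i j) := gradeP lt_dm; rewrite !mxE.
Qed.

Lemma rank_eval_rev (a : F) : a != 0 ->
  \rank (map_mx (horner_eval a) (rev_mxpoly d P)) = \rank (map_mx (horner_eval a^-1) P).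
Proof.
move=> nz_a; rewrite -[RHS](mxrank_scale_nz _ (expf_neq0 d nz_a)); congr mxrank.
apply/matrixP => i j; rewrite [LHS]mxE [RHS]mxE [X in _ * X]mxE.
by have [_ _ rev_ij] := is_reversal_mx i j; exact: rev_ij.
Qed.

Lemma eval0_rev : map_mx (horner_eval 0) (rev_mxpoly d P) = coef_matrix P d.
Proof.
apply/matrixP => i j; rewrite [LHS]mxE /horner_eval horner_coef0 [RHS]mxE.
by rewrite (is_reversal_coef (is_reversal_mx i j)) ?subn0.
Qed.

(** Each size is the largest rank of a value at a nonzero point, and a -> 1/a exchanges the values
    of P and of its reversal up to a nonzero factor. *)
Lemma size_invariant_polynomials_rev gs gs' :
    invariant_polynomials P gs -> invariant_polynomials (rev_mxpoly d P) gs' ->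
  size gs = size gs'.
Proof.
have full_rank (Q : 'M[{poly F}]_n) (hs : seq {poly F}) : invariant_polynomials Q hs ->
    (forall a, \rank (map_mx (horner_eval a) Q) <= size hs)%N /\
    exists2 a, a != 0 & \rank (map_mx (horner_eval a) Q) = size hs.
  move=> inv_hs; split=> [a|].
    by rewrite (rank_eval_invariant_polynomials a inv_hs) count_size.
  have [_ /allP mon_hs _ _] := inv_hs.
  have : \prod_(h <- hs) h != 0.
    by rewrite prodf_seq_neq0; apply/allP => h /mon_hs/monic_neq0 ->.
  case/poly_neq0_eval=> a nz_a; rewrite horner_prod prodf_seq_neq0 => /allP nz_hs.
  exists a => //; rewrite (rank_eval_invariant_polynomials a inv_hs).
  by apply/eqP; rewrite -all_count; apply/allP => h /nz_hs.
move=> /full_rank[le_rk [a nz_a eq_rk]] /full_rank[le_rk' [a' nz_a' eq_rk']].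
apply/eqP; rewrite eqn_leq; apply/andP; split.
  by rewrite -eq_rk -[a]invrK -rank_eval_rev ?invr_eq0.
by rewrite -eq_rk' rank_eval_rev.
Qed.

End Reversal.

Section SpectralData.
Variables (n d r : nat) (mu : seq F) (t : nat) (eps : seq nat) (P : 'M[{poly F}]_n).
Hypothesis dataP : has_spectral_data d r mu t eps P.

Lemma finite_structure : exists2 gs, invariant_polynomials P gs &
  size gs = r /\ \prod_(g <- gs) g = \prod_(m <- mu) ('X - m%:P).
Proof.
case: dataP => rankP _ [gs [inv_gs perm_gs]] _ _; exists gs => //.
rewrite -rankP (rank_invariant_polynomials inv_gs); split=> //.
by have [_ mon_gs _ _] := inv_gs; rewrite (prod_elementary_divisors mon_gs perm_gs) big_map.
Qed.

Lemma infinite_structure : exists2 gs, invariant_polynomials (rev_mxpoly d P) gs &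
  [/\ size gs = r, count (root^~ 0) gs = t & mup 0 (\prod_(g <- gs) g) = t].
Proof.
have [gs0 inv_gs0 [size_gs0 _]] := finite_structure.
case: dataP => _ gradeP _ infP _; move: infP.
rewrite /infinite_elementary_divisors -['X]subr0 -(polyC0 F).
case/simple_elementary_divisors_at=> gs [inv_gs count_gs mup_gs]; exists gs => //.
rewrite -size_gs0 (size_invariant_polynomials_rev gradeP inv_gs0 inv_gs); split=> //.
have [_ /allP mon_gs _ _] := inv_gs.
rewrite mup_prod; last by apply/allP => g /mon_gs/monic_neq0.
rewrite -count_gs -sum1_count [RHS]big_mkcond !big_seq /=.
by apply: eq_bigr => g /mup_gs ->; case: (root g 0).
Qed.

Lemma has_degree_spectral_data : has_degree P d <-> (t < r)%N.
Proof.
have [gs inv_gs [size_gs count_gs _]] := infinite_structure.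
case: dataP => _ gradeP _ _ _.
have rank0 : (\rank (coef_matrix P d) + t = r)%N.
  rewrite -(eval0_rev gradeP) (rank_eval_invariant_polynomials 0 inv_gs).
  by rewrite -count_gs -size_gs addnC; apply: count_predC.
rewrite /has_degree -mxrank_eq0; split=> [[rk _]|lt_tr]; first lia.
by split=> //; lia.
Qed.

End SpectralData.

(* Both sides compute the largest degree of an r x r minor of P: from the Smith
   form of P it is s + 2 * sumn eps, and from the Smith form of the reversal,
   whose minors are the reversals with respect to r d of those of P, it is
   r d - t. *)
Theorem index_sum r k d mu t eps (P : 'M[{poly F}]_(r + k)) :
    symmetric_mxpoly P -> has_spectral_data d r mu t eps P ->
  (size mu + t + 2 * sumn eps = r * d)%N.
Proof.
move=> /symmetric_mxpoly_tr trP dataP.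
have [gs inv_gs [size_gs prod_gs]] := finite_structure dataP.
have [gs' inv_gs' [size_gs' _ mup_gs']] := infinite_structure dataP.
case: dataP => rankP gradeP _ _ indP.
have [_ _ _ [U [V [unitU unitV smithP]]]] := inv_gs.
have [_ mon_gs' _ [U' [V' [unitU' unitV' smithP']]]] := inv_gs'.
have size_G : size (\prod_(g <- gs) g) = (size mu).+1.
  by rewrite prod_gs size_prod_XsubC.
have [leR [g0 sizeR]] := smith_right_minors unitU unitV size_gs smithP rankP indP.
(* As P is symmetric, its transposed Smith form is again a Smith form of P. *)
have [leL [f0 sizeL]] : (forall f : 'I_r -> 'I_(r + k),
      (size (\det (rowsub f (lsubmx (invmx U)))) <= (sumn eps).+1)%N) /\
    exists f : 'I_r -> 'I_(r + k),
      size (\det (rowsub f (lsubmx (invmx U)))) = (sumn eps).+1.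
  have unitUt : U^T \in unitmx by rewrite unitmx_tr.
  have unitVt : V^T \in unitmx by rewrite unitmx_tr.
  have := smith_right_minors unitVt unitUt size_gs (smith_tr smithP).
  rewrite trP => /(_ _ rankP indP)[leL [f0 sizeL]].
  split=> [f|]; first by rewrite det_rowsub_lsubmx_invmx.
  by exists f0; rewrite det_rowsub_lsubmx_invmx.
have le_size (f g : 'I_r -> 'I_(r + k)) :
    (size (\det (mxsub f g P)) <= (size mu + 2 * sumn eps).+1)%N.
  rewrite (smith_minor unitU unitV size_gs smithP).
  have leM (p q : {poly F}) a b : (size p <= a.+1)%N -> (size q <= b.+1)%N ->
      (size (p * q)%R <= (a + b).+1)%N.
    by move=> le_p le_q; apply: leq_trans (size_polyMleq _ _) _; lia.
  rewrite mul2n -addnn addnCA addnA.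
  by apply: (leM _ _ _ _ _ (leR g)); apply: (leM _ _ _ _ (leL f)); rewrite size_G.
(* Rows and columns are chosen independently, so both extremal degrees occur in the same minor. *)
have eq_size : size (\det (mxsub f0 g0 P)) = (size mu + 2 * sumn eps).+1.
  have nz (p : {poly F}) m : size p = m.+1 -> p != 0.
    by move=> size_p; rewrite -size_poly_eq0 size_p.
  rewrite (smith_minor unitU unitV size_gs smithP).
  have nzL := nz _ _ sizeL; have nzG := nz _ _ size_G; have nzR := nz _ _ sizeR.
  by rewrite !size_mul ?mulf_neq0 // sizeL size_G sizeR; lia.
have rev_minor (f g : 'I_r -> 'I_(r + k)) :
    is_reversal (r * d) (\det (mxsub f g P)) (\det (mxsub f g (rev_mxpoly d P))).
  apply: is_reversal_det => i j; rewrite [X in is_reversal _ X]mxE [X in is_reversal _ _ X]mxE.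
  exact: is_reversal_mx.
have nz_G' : \prod_(g <- gs') g != 0.
  by rewrite prodf_seq_neq0; apply: sub_all mon_gs' => g /monic_neq0 ->.
have [H nH0] := mup_factor 0 nz_G'; rewrite mup_gs' subr0 => G'E.
have minor' := smith_minor unitU' unitV' size_gs' smithP'.
have [g1 nz_g1] := smith_right_eval_minor unitV' 0.
have [f1 nz_f1] : exists f : 'I_r -> 'I_(r + k),
    (\det (rowsub f (lsubmx (invmx U')))).[0] != 0.
  have [f nz_f] := smith_right_eval_minor (V := U'^T) (etrans (unitmx_tr _) unitU') 0.
  by exists f; rewrite det_rowsub_lsubmx_invmx.
(* At f1 and g1 every cofactor of ['X^t] is nonzero at 0, so this minor has order exactly t. *)
have coef_t : (\det (mxsub f1 g1 (rev_mxpoly d P)))`_t != 0.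
  rewrite minor' G'E mulrA mulrAC coefMXn ltnn subnn -horner_coef0 !hornerM.
  by rewrite !mulf_neq0.
have le_t : (t <= r * d)%N.
  have [_ leq _] := rev_minor f1 g1; rewrite -ltnS (leq_trans _ leq) // ltnNge.
  by apply: contra coef_t => /leq_sizeP/(_ _ (leqnn _)) ->.
(* All minors of the reversal are divisible by ['X^t], which in grade r d bounds the degree of those
   of P. *)
have le_size' : (size (\det (mxsub f0 g0 P)) <= (r * d - t).+1)%N.
  have rev00 := rev_minor f0 g0; have [le00 _ _] := rev00.
  apply/leq_sizeP => m lt_m; have [le_m|lt_rdm] := leqP m (r * d); last first.
    by move/leq_sizeP: le00; apply.
  rewrite -[m](subKn le_m) -(is_reversal_coef rev00) ?leq_subr //.
  by rewrite minor' G'E mulrA mulrAC coefMXn; case: ltnP => //; lia.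
have ge_size : (r * d - t < size (\det (mxsub f1 g1 P)))%N.
  rewrite ltnNge; apply: contra coef_t => /leq_sizeP/(_ _ (leqnn _)).
  by rewrite (is_reversal_coef (rev_minor f1 g1)) // => ->.
(* The minor at f0, g0 gives s + 2 * sumn eps <= r d - t, and the one at f1, g1 the converse. *)
by have := le_size f1 g1; lia.
Qed.

End IndexSum.

(** * Realization of prescribed data *)

(** S is spread greedily over r places of capacity h; truncated subtraction leaves the places after
    exhaustion empty. *)
Lemma sum_minn_remainder (h S r : nat) :
  (\sum_(i < r) minn h (S - i * h) = minn S (r * h))%N.
Proof.
elim: r => [|r IHr]; first by rewrite big_ord0 mul0n minn0.
by rewrite big_ord_recr /= IHr mulSn; move: (r * h)%N => x; lia.
Qed.

Lemma sum_ltn_ord (m r : nat) : (\sum_(i < r) (i < m) = minn m r)%N.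
Proof.
elim: r => [|r IHr]; first by rewrite big_ord0 minn0.
by rewrite big_ord_recr /= IHr; case: ltnP; lia.
Qed.

(* If 2 * S > r * (d - 1) with d odd, degrees (d + 1) / 2 are unavoidable; each of
   them is paired by sigma with a degree (d - 1) / 2. *)
Lemma balanced_degrees (r d S : nat) : (2 * S <= r * d)%N ->
  exists (eta : nat -> nat) (sigma : 'I_r -> 'I_r), [/\ involutive sigma,
    (\sum_(i < r) eta i = S)%N, forall i : 'I_r, (eta i + eta (sigma i) <= d)%N &
    forall i : 'I_r, sigma i != i -> (eta i + eta (sigma i) = d)%N].
Proof.
move=> leS; pose h := d./2.
have dE : (d = odd d + 2 * h)%N by rewrite mul2n odd_double_half.
have [leSh|ltSh] := leqP S (r * h).
  (* As 2 h <= d, an index of degree at most h can be its own partner. *)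
  exists (fun i => minn h (S - i * h)), id; split=> // [|i|i].
  - by rewrite sum_minn_remainder; apply/minn_idPl.
  - lia.
  - by rewrite eqxx.
have odd_d : odd d by move: leS; rewrite dE; case: (odd d) => //; nia.
(* The first m indices get degree h + 1. Since 2 m <= r, sigma can exchange i and i + m for i < m
   and fix the indices from 2 m on. *)
rewrite odd_d /= in dE; pose m := (S - r * h)%N.
have le2m : (2 * m <= r)%N by rewrite /m; move: leS; rewrite dE; nia.
have lt_sigma (i : 'I_r) :
    ((if i < m then i + m else if i < 2 * m then i - m else i) < r)%N.
  by have := ltn_ord i; do ?case: ifP; lia.
exists (fun i => h + (i < m))%N, (fun i => Ordinal (lt_sigma i)); split.
- move=> i; apply: val_inj => /=; case: (ltnP i m) => [?|?].
    by rewrite (ltnNge (i + m)) leq_addl /=; case: ifP; lia.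
  by case: (ltnP i (2 * m)) => ?; do ?case: ifP; lia.
- rewrite big_split /= sum_nat_const card_ord sum_ltn_ord /m.
  by have := le2m; rewrite /m; lia.
- by move=> i /=; rewrite dE; do ?case: ifP; lia.
- by move=> i; rewrite -val_eqE /= dE; do ?case: ifP; lia.
Qed.

(** * Distribution of the prescribed eigenvalues over the entries of D *)

Section SimpleFactors.
Variable F : numClosedFieldType.

(* Points of the projective line, None being the point at infinity. *)
Definition factor_at (z : option F) : {poly F} :=
  if z is Some m then 'X - m%:P else 1.
Definition rev_factor_at (z : option F) : {poly F} :=
  if z is Some m then 1 - m *: 'X else 'X.

Lemma is_reversal_factor z : is_reversal 1 (factor_at z) (rev_factor_at z).
Proof.
case: z => [m|] /=; last by have := @is_reversalXn F 1 0 isT; rewrite expr0 subn0.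
apply: is_reversalD; first by have := @is_reversalXn F 1 1 isT; rewrite subnn expr0.
apply: is_reversalN; rewrite -mul_polyC -{1}[m%:P]mulr1.
by rewrite -[1%N]/(0 + 1)%N; apply: is_reversalM (is_reversalC m) (@is_reversalXn F 1 0 isT).
Qed.

Lemma root_factor_at z a : root (factor_at z) a = (z == Some a).
Proof. by case: z => [m|] /=; rewrite ?root_XsubC ?(negPf (root1 a)) // eq_sym. Qed.

Lemma root_rev_factor_at z a :
  root (rev_factor_at z) a = (z == if a == 0 then None else Some a^-1).
Proof.
case: z => [m|] /=; last by rewrite rootE hornerX; case: (a == 0).
rewrite rootE !hornerE subr_eq0; have [->|nz_a] := eqVneq a 0.
  by rewrite mulr0 oner_eq0.
rewrite (inj_eq Some_inj); apply/eqP/eqP => [ma1|->]; last by rewrite mulVf.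
by apply: (mulIf nz_a); rewrite mulVf.
Qed.

Lemma coprimep_prod_root (I J : finType) (p : I -> {poly F}) (q : J -> {poly F}) :
    (forall i j a, root (p i) a -> ~~ root (q j) a) ->
  coprimep (\prod_i p i) (\prod_j q j).
Proof.
move=> disj; apply: Pdiv.ClosedField.root_coprimep => a.
rewrite rootE horner_prod => /prodf_eq0[i _ pia].
by rewrite horner_prod; apply/prodf_neq0 => j _; apply: disj pia.
Qed.

(** The eigenvalues, with infinity when t = 1, are distinct points of the projective line, and there
    is one for each of the e_i slots of the p_i. Distinctness gives coprimality, also after
    reversal. *)
Lemma distribute_simple_factors r (e : 'I_r -> nat) (mu : seq F) t :
    uniq mu -> (t <= 1)%N -> (\sum_i e i = size mu + t)%N ->
  exists p p' : 'I_r -> {poly F},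
  [/\ forall i, is_reversal (e i) (p i) (p' i),
      forall i, e i = 0%N -> p i = 1 /\ p' i = 1,
      (forall i, p i != 0) /\ (forall i j, i != j -> coprimep (p i) (p j)),
      (forall i, p' i != 0) /\ (forall i j, i != j -> coprimep (p' i) (p' j)) &
      \prod_i p i = \prod_(m <- mu) ('X - m%:P) /\ mup 0 (\prod_i p' i) = t].
Proof.
move=> uniq_mu le_t1 sum_e.
pose zs := map Some mu ++ nseq t None.
have size_zs : size zs = (size mu + t)%N by rewrite size_cat size_map size_nseq.
have uniq_zs : uniq zs.
  rewrite cat_uniq map_inj_uniq ?uniq_mu /=; last exact: Some_inj.
  have -> : uniq (nseq t (None : option F)) by case: (t) le_t1 => [|[]].
  rewrite andbT; apply/hasPn => z.
  by rewrite mem_nseq => /andP[_ /eqP->]; apply/negP => /mapP[].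
pose T : finType := {i : 'I_r & 'I_(e i)}.
pose tg i (j : 'I_(e i)) : T := Tagged (fun i => 'I_(e i)) j.
have cardT : #|T| = size zs.
  rewrite size_zs -sum_e -sum1_card.
  transitivity (\sum_(i < r) \sum_(j < e i) 1)%N; first by rewrite sig_big_dep.
  by apply: eq_bigr => i _; rewrite sum1_card card_ord.
(* The default [None] is never reached, there being as many slots as points. *)
pose z (x : T) := nth None zs (enum_rank x).
have inj_z : injective z.
  move=> x y /eqP; rewrite nth_uniq ?uniq_zs -?cardT ?ltn_ord // => /eqP/ord_inj.
  exact: enum_rank_inj.
have prod_zs (f : option F -> {poly F}) :
    \prod_i \prod_(j < e i) f (z (tg i j)) = \prod_(y <- zs) f y.
  rewrite (sig_big_dep xpredT (fun _ _ => true) (fun i j => f (z (tg i j)))) /=.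
  rewrite (big_nth None) big_mkord -cardT (reindex (@enum_val T T)) /=; last first.
    by apply: onW_bij; apply: enum_val_bij.
  apply: eq_bigr => i _; have tgK x : tg (tag x) (tagged x) = x by case: x.
  by rewrite tgK /z enum_valK.
exists (fun i => \prod_(j < e i) factor_at (z (tg i j))).
exists (fun i => \prod_(j < e i) rev_factor_at (z (tg i j))).
have nz_rev y : rev_factor_at y != 0.
  apply/eqP => y0; have := root_rev_factor_at y 0; have := root_rev_factor_at y 1.
  by rewrite y0 !root0 eqxx oner_eq0 => /esym/eqP ->.
have nz_f y : factor_at y != 0.
  apply/eqP => y0; have := root_factor_at y 0; have := root_factor_at y 1.
  by rewrite y0 !root0 => /esym/eqP -> /esym/eqP[] /eqP; rewrite oner_eq0.
split.
- move=> i; rewrite -{1}(card_ord (e i)) -sum1_card.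
  by apply: is_reversal_prod => j _; apply: is_reversal_factor.
- by move=> i ei0; split; apply: big1 => -[j lt_j]; exfalso; rewrite ei0 in lt_j.
- split=> [i|i j ne_ij]; first by apply/prodf_neq0.
  apply: coprimep_prod_root => u v a; rewrite !root_factor_at => /eqP <-.
  by apply: contra ne_ij => /eqP/inj_z/(congr1 tag)/= ->.
- split=> [i|i j ne_ij]; first by apply/prodf_neq0.
  apply: coprimep_prod_root => u v a; rewrite !root_rev_factor_at => /eqP <-.
  by apply: contra ne_ij => /eqP/inj_z/(congr1 tag)/= ->.
(* Infinity contributes 1 to the first product and ['X] to the reversed one, whose other factors
   take the value 1 at 0. *)
rewrite !prod_zs !big_cat !big_map /=; split.
  by rewrite [X in _ * X]big_nseq /= iter_fix ?mulr1.
rewrite [X in _ * X]big_nseq iter_mulr_1 mupMr.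
  by have := mup_XsubCX t (0 : F) 0; rewrite polyC0 subr0 eqxx.
rewrite rootE horner_prod prodf_seq_neq0; apply/allP => m _.
by rewrite -rootE (root_rev_factor_at (Some m)) eqxx.
Qed.

End SimpleFactors.

(** * Dual minimal bases with prescribed row degrees *)

Section Zigzag.

(** Once the unimodular block is moved to the front, adding the rows [0 | 1] gives a block
    triangular matrix. *)
Lemma unimodular_completion (F : fieldType) r k (M : 'M[{poly F}]_(r, r + k)) (f : 'I_r -> 'I_(r + k)) :
  colsub f M \in unitmx -> exists2 W : 'M_(r + k), W \in unitmx & usubmx W = M.
Proof.
move=> unit_f; have inj_f : injective f.
  apply/injectiveP; apply: contraLR unit_f => /injectiveP ninj_f.
  by rewrite unitmxE det_colsub_noninj // unitr0.
have [s sE] := perm_of_injections (@lshift_inj r k) inj_f.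
pose W := block_mx (lsubmx (col_perm s M)) (rsubmx (col_perm s M)) 0 1%:M.
exists (col_perm s^-1 W).
  rewrite col_permE unitmx_mul unitmx_perm andbT unitmxE det_ublock det1 mulr1.
  rewrite (_ : lsubmx _ = colsub f M) -?unitmxE //.
  by apply/matrixP => i j; rewrite !mxE sE.
have -> : usubmx (col_perm s^-1 W) = col_perm s^-1 (usubmx W).
  by apply/matrixP => i j; rewrite !mxE.
by rewrite /W block_mxEv col_mxKu hsubmxK -col_permM mulVg col_perm1.
Qed.

Lemma sum_bidiagonal (R : comNzRingType) n (i : 'I_n) (c : R) (f : nat -> R) :
  \sum_(l < n) (if l == i then 1 else if l == i.+1 :> nat then c else 0) * f l =
  f i + (if (i.+1 < n)%N then c * f i.+1 else 0).
Proof.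
rewrite (bigD1 i) //= eqxx mul1r; congr (_ + _).
case: ltnP => [lt_in|le_ni].
  rewrite (bigD1 (Ordinal lt_in)) /=; last by rewrite -val_eqE /= (gtn_eqF (ltnSn i)).
  rewrite -val_eqE /= (gtn_eqF (ltnSn i)) eqxx big1 ?addr0 // => l /andP[/negPf -> ].
  by rewrite -val_eqE /= => /negPf ->; rewrite mul0r.
rewrite big1 // => l /negPf ->; rewrite (ltn_eqF (leq_trans (ltn_ord l) le_ni)).
by rewrite mul0r.
Qed.

Lemma sum_bidiagonal_pred (R : comNzRingType) n (i : 'I_n) (c : R) (f : nat -> R) :
  \sum_(l < n) (if l == i then 1 else if l.+1 == i :> nat then c else 0) * f l =
  f i + (if (0 < i)%N then c * f i.-1 else 0).
Proof.
rewrite (bigD1 i) //= eqxx mul1r; congr (_ + _).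
case: (posnP i) => [i0|i_gt0].
  by rewrite big1 // => l /negPf ->; rewrite i0 mul0r.
have lt_in : (i.-1 < n)%N by apply: leq_ltn_trans (leq_pred _) (ltn_ord i).
rewrite (bigD1 (Ordinal lt_in)) /=; last by rewrite -val_eqE /= -{2}(prednK i_gt0) (ltn_eqF (ltnSn _)).
rewrite -val_eqE /= -{2}(prednK i_gt0) (ltn_eqF (ltnSn _)) prednK // eqxx big1 ?addr0 //.
move=> l /andP[/negPf -> ]; rewrite -val_eqE /= -eqSS prednK // => /negPf ->.
by rewrite mul0r.
Qed.

Variables (F : numFieldType) (r k : nat) (eta eps : nat -> nat).
Hypothesis sum_eq : (\sum_(i < r.+1) eta i = \sum_(j < k.+1) eps j)%N.

Let a i := (\sum_(l < i) eta l)%N.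
Let b j := (\sum_(l < j) eps l)%N.
Let aS i : a i.+1 = (a i + eta i)%N. Proof. exact: big_ord_recr. Qed.
Let bS j : b j.+1 = (b j + eps j)%N. Proof. exact: big_ord_recr. Qed.
Let a0 : a 0 = 0%N. Proof. exact: big_ord0. Qed.
Let b0 : b 0 = 0%N. Proof. exact: big_ord0. Qed.
Let ab : a r.+1 = b k.+1. Proof. exact: sum_eq. Qed.
Let a_mono : {homo a : i j / (i <= j)%N}.
Proof. by apply: (homo_leq (r := leq) leqnn leq_trans) => i; rewrite aS leq_addr. Qed.
Let b_mono : {homo b : i j / (i <= j)%N}.
Proof. by apply: (homo_leq (r := leq) leqnn leq_trans) => i; rewrite bS leq_addr. Qed.

(* The rows of T [1 | G] and Z [- G^T | 1] span orthogonal spaces whatever G is.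
   With a and b the partial sums of eta and eps, multiplying the staircase G by
   the bidiagonal T and Z telescopes, and cuts the row degrees down to eta and
   eps. *)
Let T : 'M[{poly F}]_r.+1 := \matrix_(i, l)
  if l == i then 1 else if l == i.+1 :> nat then - 'X^(eta i) else 0.
Let Z : 'M[{poly F}]_k.+1 := \matrix_(j, l)
  if l == j then 1 else if l.+1 == j :> nat then - 'X^(eps j) else 0.
Let stair i j : {poly F} := if (a i <= b j)%N then 'X^(b j - a i) else 0.
Let G : 'M[{poly F}]_(r.+1, k.+1) := \matrix_(i, j) stair i j.+1.

(** Row i of G is ['X^(eta i)] times row i + 1 wherever the latter is nonzero, so only the b_(j+1)
    in [a_i, a_(i+1)) survive. The last row has no successor to cancel it. *)
Let TG i j : (T *m G) i j =
  if (a i <= b j.+1)%N && ((i == r :> nat) || (b j.+1 < a i.+1)%N)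
  then 'X^(b j.+1 - a i) else 0.
Proof.
rewrite mxE (eq_bigr (fun l : 'I_r.+1 =>
  (if l == i then 1 else if l == i.+1 :> nat then - 'X^(eta i) else 0) * stair l j.+1)).
  rewrite (sum_bidiagonal i _ (fun l => stair l j.+1)) ltnS /stair aS.
  have := ltn_ord i; rewrite ltnS leq_eqVlt => /orP[/eqP->|lt_ir].
    by rewrite ltnn eqxx andbT addr0.
  rewrite lt_ir (ltn_eqF lt_ir) /= ltnNge; case: (leqP (a i + eta i) (b j.+1)) => le_ab /=.
    by rewrite (leq_trans (leq_addr _ _) le_ab) /= mulNr -exprD subnDA subnKC ?subrr //; lia.
  by rewrite mulr0 addr0 andbT.
by move=> l _; rewrite !mxE.
Qed.

(** Dually, the entries with b_j < a_i <= b_(j+1) survive, and the first row has no predecessor to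
    cancel it. *)
Let ZG j i : (Z *m G^T) j i =
  if (a i <= b j.+1)%N && ((j == 0 :> nat) || (b j < a i)%N)
  then 'X^(b j.+1 - a i) else 0.
Proof.
rewrite mxE (eq_bigr (fun l : 'I_k.+1 =>
  (if l == j then 1 else if l.+1 == j :> nat then - 'X^(eps j) else 0) * stair i l.+1)).
  rewrite (sum_bidiagonal_pred j _ (fun l => stair i l.+1)) lt0n; case: (nat_of_ord j) => [|m] /=.
    by rewrite addr0 andbT.
  rewrite /stair ltnNge bS; case: (leqP (a i) (b m.+1)) => le_ab /=.
    by rewrite (leq_trans le_ab) ?leq_addr //= mulNr -exprD addnBA // [(eps _ + _)%N]addnC subrr.
  by rewrite mulr0 addr0 andbT.
by move=> l _; rewrite !mxE.
Qed.

Let N := row_mx (- (Z *m G^T)) Z.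
(** This is the reversal of [T | T G], row i being taken in grade [eta i]. *)
Let M' : 'M[{poly F}]_(r.+1, r.+1 + k.+1) := row_mx
  (\matrix_(i, l) if l == i then 'X^(eta i) else if l == i.+1 :> nat then -1 else 0)
  (\matrix_(i, j) if (a i <= b j.+1)%N && ((i == r :> nat) || (b j.+1 < a i.+1)%N)
     then 'X^(eta i - (b j.+1 - a i)) else 0).

Let det_T : \det T = 1.
Proof.
rewrite -det_tr det_trig; last first.
  apply/is_trig_mxP => i j lt_ij; rewrite !mxE -val_eqE /= (ltn_eqF lt_ij).
  by rewrite (ltn_eqF (ltnW _)).
by apply: big1 => i _; rewrite !mxE eqxx.
Qed.

Let det_Z : \det Z = 1.
Proof.
rewrite det_trig; last first.
  apply/is_trig_mxP => i j lt_ij; rewrite !mxE -val_eqE /= (gtn_eqF lt_ij).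
  by rewrite (gtn_eqF (leqW lt_ij)).
by apply: big1 => i _; rewrite !mxE eqxx.
Qed.

Let is_reversal_zigzag (i : 'I_r.+1) y : is_reversal (eta i) (row_mx T (T *m G) i y) (M' i y).
Proof.
have rev1 m : is_reversal m (1 : {poly F}) 'X^m.
  by have := is_reversalXn F (leq0n m); rewrite subn0 expr0.
have revX m : is_reversal m 'X^m (1 : {poly F}).
  by have := is_reversalXn F (leqnn m); rewrite subnn expr0.
rewrite -[y]splitK; case: (split y) => j /=; rewrite ?row_mxEl ?row_mxEr.
  rewrite !mxE; case: ifP => // _; case: ifP => _; first exact/is_reversalN.
  exact: is_reversal0.
rewrite TG mxE; case: ifP => [/andP[le_ab cond]|_]; last exact: is_reversal0.
apply: is_reversalXn; rewrite leq_subLR -aS; case/orP: cond => [/eqP ir|/ltnW //].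
by rewrite ir ab; apply: b_mono.
Qed.

(** Left column i + 1 of M' has -1 in row i and zeros above; the last column is 1 in row r and 0
    elsewhere, because a_(r+1) = b_(k+1). Together they are lower triangular. *)
Let piv (i : 'I_r.+1) : 'I_(r.+1 + k.+1) :=
  if (i < r)%N then lshift k.+1 (inord i.+1) else rshift r.+1 ord_max.

Let unit_piv : colsub piv M' \in unitmx.
Proof.
have entry i l : colsub piv M' i l =
    if (l < r)%N then (if l.+1 == i :> nat then 'X^(eta i) else if l == i then -1 else 0)
    else if i == r :> nat then 1 else 0.
  rewrite mxE /piv; case: ltnP => [lt_lr|le_rl].
    by rewrite row_mxEl mxE -!val_eqE /= inordK ?ltnS // eqSS.
  rewrite row_mxEr mxE /= -ab; have [ir|ne_ir] := eqVneq (i : nat) r.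
    by rewrite ir a_mono //= aS addKn subnn expr0.
  by rewrite [(a r.+1 < _)%N]ltnNge (a_mono (ltn_ord i)) andbF.
rewrite unitmxE det_trig; last first.
  apply/is_trig_mxP => i j lt_ij; rewrite entry -val_eqE /= (gtn_eqF lt_ij).
  rewrite (gtn_eqF (leqW lt_ij)); case: ltnP => // _.
  by rewrite (ltn_eqF (leq_trans lt_ij _)) // -ltnS.
elim/big_ind: _ => [||i _]; [exact: unitr1|by move=> *; rewrite unitrM; apply/andP|].
rewrite entry eqxx; case: ltnP => [_|le_ri]; first by rewrite (gtn_eqF (ltnSn _)) unitrN1.
by rewrite eqn_leq le_ri -ltnS ltn_ord unitr1.
Qed.

(** These columns of N form a triangular matrix with diagonal entries [- 'X^(eps j)]: the row
    degrees eps j are attained, and so is their sum by a maximal minor. *)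
Let start (j : 'I_k.+1) : 'I_(r.+1 + k.+1) :=
  if (0 < j)%N then rshift r.+1 (inord j.-1) else lshift k.+1 ord0.

Let startE (j l : 'I_k.+1) : N j (start l) =
  if (0 < l)%N then (if l.-1 == j :> nat then 1 else if l == j then - 'X^(eps j) else 0)
  else if j == 0 :> nat then - 'X^(eps j) else 0.
Proof.
rewrite /start; case: posnP => [l0|l_gt0].
  rewrite row_mxEl mxE ZG /= a0 subn0 leq0n ltn0 orbF /=.
  by case: eqP => [->|_]; rewrite ?oppr0 // bS b0.
by rewrite row_mxEr mxE -!val_eqE /= inordK ?prednK // ltnW.
Qed.

Let size_N (j : 'I_k.+1) y : (size (N j y) <= (eps j).+1)%N.
Proof.
rewrite -[y]splitK; case: (split y) => l /=; rewrite ?row_mxEl ?row_mxEr.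
  rewrite mxE size_polyN ZG; case: ifP => [|_]; last by rewrite size_poly0.
  case/andP=> _ cond; rewrite size_polyXn ltnS leq_subLR bS.
  by case/orP: cond => [/eqP->|/ltnW]; rewrite ?b0 ?leq_add2r // leq_addl.
rewrite mxE; case: ifP => _; first by rewrite size_poly1.
by case: ifP => _; rewrite ?size_poly0 // size_polyN size_polyXn.
Qed.

Lemma dual_minimal_bases_pos : exists W W' : 'M[{poly F}]_(r.+1 + k.+1),
  exists (N : 'M[{poly F}]_(k.+1, r.+1 + k.+1)) C,
  [/\ W \in unitmx /\ W' \in unitmx,
      forall (i : 'I_r.+1) y, is_reversal (eta i) (usubmx W i y) (usubmx W' i y),
      N *m (usubmx W)^T = 0 /\ N *m C = 1%:M,
      forall j : 'I_k.+1, (\max_y (size (N j y)).-1)%N = eps j &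
      exists g, size (\det (colsub g N)) = (\sum_(j < k.+1) eps j).+1].
Proof.
have [W' unitW' W'E] := unimodular_completion unit_piv.
(* [T | T G] begins with the unimodular T and N ends with the unimodular Z, which gives the
   completion of one and the right inverse of the other. *)
exists (block_mx T (T *m G) 0 1%:M), W', N, (col_mx 0 (invmx Z)).
have unitZ : Z \in unitmx by rewrite unitmxE det_Z unitr1.
rewrite block_mxEv col_mxKu; split.
- by rewrite unitW' -block_mxEv unitmxE det_ublock det_T det1 mulr1 unitr1.
- by move=> i y; rewrite W'E; apply: is_reversal_zigzag.
- rewrite tr_row_mx !mul_row_col mulmx0 add0r mulmxV // trmx_mul mulNmx mulmxA.
  by rewrite addNr.
- move=> j; apply/eqP; rewrite eqn_leq; apply/andP; split.
    by apply/bigmax_leqP => y _; have := size_N j y; case: (size _).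
  apply: leq_trans (leq_bigmax (start j)); rewrite startE.
  case: posnP => [->|j_gt0]; first by rewrite size_polyN size_polyXn.
  by rewrite (ltn_eqF (etrans (ltn_predL j) j_gt0)) eqxx size_polyN size_polyXn.
exists start; rewrite -det_tr det_trig; last first.
  apply/is_trig_mxP => i j lt_ij; rewrite mxE mxE startE -val_eqE /=.
  case: posnP => [i0|i_gt0]; first by rewrite gtn_eqF // (leq_ltn_trans _ lt_ij).
  by rewrite !ltn_eqF // (leq_ltn_trans (leq_pred _)).
have diag (j : 'I_k.+1) : (colsub start N)^T j j = - 'X^(eps j).
  rewrite mxE mxE startE; case: posnP => [->|j_gt0] //.
  by rewrite (ltn_eqF (etrans (ltn_predL j) j_gt0)) eqxx.
under eq_bigr do rewrite diag -mulN1r.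
by rewrite big_split /= prodr_const size_Msign prodrXr size_polyXn.
Qed.

End Zigzag.

(** * Construction of P from the dual bases and D *)

Section Realization.
Variable F : numClosedFieldType.

Lemma dual_minimal_bases r k (eta eps : nat -> nat) :
    (\sum_(i < r.+1) eta i = \sum_(j < k) eps j)%N ->
  exists W W' : 'M[{poly F}]_(r.+1 + k),
  exists (N : 'M[{poly F}]_(k, r.+1 + k)) C,
  [/\ W \in unitmx /\ W' \in unitmx,
      forall (i : 'I_r.+1) y, is_reversal (eta i) (usubmx W i y) (usubmx W' i y),
      N *m (usubmx W)^T = 0 /\ N *m C = 1%:M,
      forall j : 'I_k, row_degree N j = eps j &
      exists g, size (\det (colsub g N)) = (\sum_(j < k) eps j).+1].
Proof.
case: k => [|k] sum_eq; last exact: dual_minimal_bases_pos.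
(* For k = 0 the sum condition forces every [eta i] to be 0. *)
exists 1%:M, 1%:M, 0, 0; split.
- by rewrite unitmx1.
- have eta0 (i : 'I_r.+1) : eta i = 0%N.
    by move: sum_eq; rewrite big_ord0 => /eqP; rewrite sum_nat_eq0 => /forallP/(_ i)/eqP.
  move=> i y; rewrite eta0 !mxE; case: eqP => _; first exact: is_reversal1.
  exact: is_reversal0.
- by split; apply/matrixP => -[].
- by case.
- by exists (fun=> ord0); rewrite det_mx00 size_poly1 big_ord0.
Qed.

Lemma perm_diag_equivalent n (p : 'I_n -> {poly F}) (sigma : 'I_n -> 'I_n) :
    involutive sigma ->
  mx_equivalent (\matrix_(i, j) if j == sigma i then p i else 0)
    (diag_mx (\row_i p i)).
Proof.
move=> inv_sigma; pose s := perm (inv_inj inv_sigma).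
exists 1%:M, (invmx (perm_mx s)); rewrite unitmx1 unitmx_inv unitmx_perm; split=> //.
have -> : \matrix_(i, j) (if j == sigma i then p i else 0) = diag_mx (\row_i p i) *m perm_mx s.
  apply/matrixP => i j; rewrite mul_diag_mx !mxE permE eq_sym.
  by case: eqP => _; rewrite ?mulr1 ?mulr0.
by rewrite mul1mx mulmxK ?unitmx_perm.
Qed.

Lemma flatten_prime_power_factors m (g : {poly F}) :
  flatten [seq prime_power_factors h | h <- rcons (nseq m 1) g] = prime_power_factors g.
Proof. by elim: m => [|m IHm] /=; rewrite ?cats0 // prime_power_factors1. Qed.

Lemma mx_congruence_invariants r k (W : 'M[{poly F}]_(r.+1 + k)) (p : 'I_r.+1 -> {poly F})
    (sigma : 'I_r.+1 -> 'I_r.+1) (q := \prod_i p i) :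
    W \in unitmx -> involutive sigma ->
    (forall i, p i != 0) -> (forall i j, i != j -> coprimep (p i) (p j)) ->
  invariant_polynomials
    ((usubmx W)^T *m (\matrix_(i, j) if j == sigma i then p i else 0) *m usubmx W)
    (rcons (nseq r 1) ((lead_coef q)^-1 *: q)).
Proof.
move=> unitW inv_sigma nz_p cop_p; apply: invariant_polynomials_congruence => //.
apply: invariant_polynomials_equivalent (perm_diag_equivalent p inv_sigma) _.
have -> : q = \prod_i (\row_i p i) 0 i by apply: eq_bigr => i _; rewrite mxE.
by apply: invariant_polynomials_coprime_diag => [x|x y]; rewrite !mxE; auto.
Qed.

Lemma realization r k d (mu : seq F) t (eps : k.-tuple nat) :
    uniq mu -> (t <= 1)%N ->
    (size mu + t + 2 * sumn eps = r.+1 * d)%N ->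
  exists P : 'M[{poly F}]_(r.+1 + k),
    symmetric_mxpoly P /\ has_spectral_data d r.+1 mu t eps P.
Proof.
move=> uniq_mu le_t1 index.
have [|eta [sigma [inv_sigma sum_eta le_d eq_d]]] := @balanced_degrees r.+1 d (sumn eps).
  by rewrite -index; lia.
have sum_eps : (\sum_(j < k) nth 0%N eps j = sumn eps)%N.
  by rewrite sumnE (big_nth 0%N) size_tuple big_mkord.
have [W [W' [N [C [[unitW unitW'] revW [NW NC] degN [g size_g]]]]]] :=
  dual_minimal_bases (etrans sum_eta (esym sum_eps)).
(* This is the grade left for p_i; by the index condition the total is s + t, one for each point to
   be placed. *)
pose e (i : 'I_r.+1) := (d - (eta i + eta (sigma i)))%N.
have sum_e : (\sum_i e i = size mu + t)%N.
  have : (\sum_i (e i + (eta i + eta (sigma i))) = r.+1 * d)%N.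
    by rewrite (eq_bigr (fun=> d)) ?sum_nat_const ?card_ord // => i _; rewrite subnK.
  have sum_sigma : (\sum_i eta (sigma i) = sumn eps)%N.
    by rewrite -sum_eta [RHS](reindex_inj (inv_inj inv_sigma)).
  by rewrite !big_split /= sum_eta sum_sigma -index; lia.
have [p [p' [revp p1 [nzp copp] [nzp' copp'] [prodp mup_p']]]] :=
  distribute_simple_factors uniq_mu le_t1 sum_e.
pose D (q : 'I_r.+1 -> {poly F}) : 'M[{poly F}]_r.+1 :=
  \matrix_(i, j) if j == sigma i then q i else 0.
pose P := (usubmx W)^T *m D p *m usubmx W.
have revP x y : is_reversal d (P x y) (((usubmx W')^T *m D p' *m usubmx W') x y).
  apply: (is_reversal_mulmx (a := fun i => eta i) (b := fun i => eta i)).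
  - by move=> z i; rewrite !mxE; have := revW i z; rewrite !mxE.
  - exact: revW.
  - move=> i j; rewrite !mxE; case: eqP => [->|_]; [right|by left].
    by exists (e i) => //; rewrite /e; have := le_d i; lia.
have rev_PE : rev_mxpoly d P = (usubmx W')^T *m D p' *m usubmx W'.
  apply/matrixP => x y; apply: is_reversal_inj (revP x y).
  by rewrite [X in is_reversal _ _ X]mxE; apply: is_reversal_poly; have [] := revP x y.
have inv_P := mx_congruence_invariants unitW inv_sigma nzp copp.
have inv_P' := mx_congruence_invariants unitW' inv_sigma nzp' copp'.
(* An index moved by sigma has e i = 0, hence p i = 1; this makes D symmetric. *)
have p_sigma i : p (sigma i) = p i.
  have [->//|ne_si] := eqVneq (sigma i) i.
  have ei0 : e i = 0%N by rewrite /e eq_d ?subnn.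
  have es0 : e (sigma i) = 0%N by rewrite /e inv_sigma addnC eq_d ?subnn.
  by rewrite (proj1 (p1 _ ei0)) (proj1 (p1 _ es0)).
have trD : (D p)^T = D p.
  apply/matrixP => i j; rewrite !mxE eq_sym (can2_eq inv_sigma inv_sigma).
  by case: eqP => // ->; rewrite p_sigma.
have trP : P^T = P by rewrite /P !trmx_mul trmxK trD mulmxA.
exists P; split; first by move=> l; apply/matrixP => i j; rewrite -{2}trP !mxE.
have rankP : mxpoly_rank P = r.+1.
  by rewrite (rank_invariant_polynomials inv_P) size_rcons size_nseq.
split=> //.
- move=> l lt_dl; apply/matrixP => x y; rewrite [LHS]mxE [RHS]mxE nth_default //.
  by have [le_d1 _ _] := revP x y; apply: leq_trans le_d1 lt_dl.
- eexists; split; first exact: inv_P.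
  rewrite flatten_prime_power_factors prodp (monicP (monic_prod_XsubC _ _ _)).
  by rewrite invr1 scale1r prime_power_factors_simple.
- rewrite /infinite_elementary_divisors rev_PE; eexists; split.
    by eexists; split; [exact: inv_P'|exact: perm_refl].
  set q := \prod_i p' i in mup_p' inv_P' *.
  have nz_q : q != 0 by apply/prodf_neq0.
  have nz_lq : (lead_coef q)^-1 != 0 by rewrite invr_eq0 lead_coef_eq0.
  rewrite flatten_prime_power_factors root_prime_power_factors; last first.
    by rewrite monicE lead_coefZ mulVf // lead_coef_eq0.
  rewrite -mul_polyC mupMr ?mup_p' ?rootC // mul_polyC rootZ // polyC0 subr0.
  (* Either q vanishes at 0, and t = 1 with the single elementary divisor ['X] there, or t = 0 and
     there is none. *)
  case: ifP => [q0|/negbT/mupNroot]; last by rewrite mup_p' => ->.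
  have t_gt0 : (0 < t)%N.
    by rewrite -mup_p' -XsubC_dvd // dvdp_XsubCl.
  by have -> : t = 1%N by apply/eqP; rewrite eqn_leq le_t1.
exists k, N; split; last first.
  rewrite (_ : [seq _ | _ : _] = eps) //.
  apply: (@eq_from_nth _ 0%N); rewrite size_map -cardE card_ord ?size_tuple // => j lt_jk.
  by rewrite (nth_map (Ordinal lt_jk)) -?cardE ?card_ord // degN nth_enum_ord.
apply: (minimal_basis_criterion _ NC (g := g)); last first.
  by rewrite size_g; congr _.+1; apply: eq_bigr => j _.
apply: polynomial_basis_kermx rankP _ _ _ => //; first exact: row_free_right_inverse NC.
by rewrite trP /P !mulmxA NW !mul0mx.
Qed.

End Realization.

Theorem theorem4p1 (R : realType) (n d r : nat)
  (n_gt0 : (0 < n)%N) (d_gt0 : (0 < d)%N) (r_gt0 : (0 < r)%N)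
  (r_le_n : (r <= n)%N)
  (s : nat) (mu : s.-tuple R[i]) (mu_uniq : uniq mu)
  (t : nat) (t01 : t = 0%N \/ t = 1%N)
  (eps : (n - r).-tuple nat) :
  [/\ (exists P : 'M[{poly R[i]}]_n,
         symmetric_mxpoly P /\ has_spectral_data d r mu t eps P) <->
      (s + t + 2 * \sum_(i < n - r) tnth eps i = r * d)%N,
      (forall P : 'M[{poly R[i]}]_n,
         symmetric_mxpoly P -> has_spectral_data d r mu t eps P ->
         left_minimal_indices P eps) &
      ((s + t + 2 * \sum_(i < n - r) tnth eps i = r * d)%N ->
       forall P : 'M[{poly R[i]}]_n,
         symmetric_mxpoly P -> has_spectral_data d r mu t eps P ->
         (has_degree P d <-> (t < r)%N))].
Proof.
have sum_eps : (\sum_(i < n - r) tnth eps i = sumn eps)%N.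
  by rewrite sumnE big_tuple.
rewrite sum_eps; have := subnKC r_le_n.
(* Writing n as r + k makes the block decompositions well typed. *)
move: (n - r)%N eps {sum_eps r_le_n} => k eps nE; subst n.
split.
- split=> [[P [symP dataP]]|index]; first by rewrite -(index_sum symP dataP) size_tuple.
  case: r r_gt0 n_gt0 index => // r' _ _ index.
  by apply: realization; rewrite ?size_tuple //; case: t01 => ->.
- by move=> P /symmetric_mxpoly_tr trP [_ _ _ _]; rewrite /right_minimal_indices /frac_mx map_trmx trP.
- by move=> _ P _; apply: has_degree_spectral_data.
Qed.
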